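(* Let $A\in \mathcal{B}(\mathbb{R}^d)$, $\mu\in\widehat{\mathbb{R}^d}$, and let $\widehat{X}= (\widehat{X}_t)_{t\geqslant 0}$ be the branching process with state space $\widehat{\mathbb{R}^d}$ associated with $(q_k)_{k\geqslant1}$ and the $d$-dimensional Brownian motion. Then $$\big|\mathbb{E}^\mu(\widehat X_t \in \widehat A) - \widehat{C(1_A)}\, \mathbb{E}^\mu (\widehat B^{1-q_1}_t\in \widehat A)\big|\leqslant \frac{l_1\,o(1)}{e^{t(1-q_1)} \, t^{d/2}},\qquad t >0,$$ where $\widehat B^{1-q_1}$ is the $(1-q_1)$-subprocess of the Brownian motion $\widehat B$ on $\widehat{\mathbb{R}^d}$.
   Context: $d\geqslant1$ is an integer. $(q_k)_{k\geqslant 1}$ is a sequence of nonnegative numbers with $\sum_{k\geqslant 1}q_k=1$ and $1<\sum_{k\geqslant 1}kq_k<\infty$. $\mathcal{B}(\mathbb{R}^d)$ is the Borel $\sigma$-algebra of $\mathbb{R}^d$. Configurations: $E=\mathbb{R}^d$ and $\widehat{E}=\widehat{\mathbb{R}^d}$ is the set of all finite sums of Dirac measures $\sum_{1\leqslant k\leqslant k_0}\delta_{x_k}$, $k_0\geqslant1$, $x_k\in E$, together with the zero measure $\mathbf{0}$. It is identified with $\bigcup_{m\geqslant 0}E^{(m)}$, where $E^{(m)}$ is the $m$-th symmetric power of $E$ and $E^{(0)}=\{\mathbf{0}\}$, with the disjoint-union topology and its Borel $\sigma$-algebra. $\widehat A\subset\widehat E$ is the set of finite configurations of points of $A$ (including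 $\mathbf 0$), so that $1_{\widehat A}=\widehat{1_A}$ in the following notation: for a nonnegative Borel function $\psi$ on $E$ (in particular a nonnegative constant), $\widehat{\psi}:\widehat E\to\mathbb{R}_+$ is $\widehat{\psi}(\sum_{k}\delta_{x_k})=\prod_k\psi(x_k)$, $\widehat\psi(\mathbf{0})=1$. The function $l_1:\widehat E\to\mathbb{R}$ equals $k$ on $E^{(k)}$, $k\geqslant 0$. In the claim, $\widehat{C(1_A)}$ and $l_1$ are evaluated at $\mu$, $\mathbb{E}^\mu(Z\in\Gamma)$ denotes the probability that $Z\in\Gamma$ for the process started at $\mu$ (the expectation of the indicator), and $o(1)$ refers to $t\to\infty$. $\widehat B$, the Brownian motion on $\widehat{\mathbb{R}^d}$, is the Markov process whose transition function $(\mathbf{P}_t)_{t\geqslant 0}$ is, on $E^{(k)}$, the symmetrization of the $k$-fold product of the $d$-dimensional Wiener (heat) semigroup $(P_t)$ ($k$ particles move as $k$ independent Brownian motions). In the normalization used here $P_t\varphi=K_t*\varphi$, with generator $\Delta$ and $K_t$ the heat kernel. The $(1-q_1)$-subprocess $\widehat B^{1-q_1}$ is the right process with transition function $(e^{-(1-q_1)t}\mathbf{P}_t)_{t\geqslant0}$. $\widehat X$ is the branching process on $\widehat{\mathbb{R}^d}$ (a Markov process such that, for all $\mu_1,\mu_2\in\widehat E$, the process started from $\mu_1+\mu_2$ is equal in distribution to the sum of independent copies started from $\mu_1$ and from $\mu_2$) whose transition function $(\mathbf{H}_t)_{t\geqslant 0}$ satisfies $\mathbf{H}_t\widehat\varphi=\widehat{u(\cdot,t)}$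 for all Borel $\varphi$ with $0\leqslant\varphi\leqslant1$, where $u$ is the unique global mild solution with values in $[0,1]$ of $u_t=\Delta u-u+\sum_{k\geqslant1}q_ku^k$, $u(\cdot,0)=\varphi$. The constant $C(1_A)$ is $C(\varphi)$ for $\varphi=1_A$, where, for $\varphi\in L^1(\mathbb{R}^d)$ with $0\leqslant\varphi\leqslant1$, $C(\varphi)$ denotes the positive constant for which it is established that $t^{d/2}\,|e^{t(1-q_1)}\mathbf{H}_t\widehat\varphi-\widehat{C(\varphi)}\,\mathbf{P}_t\widehat\varphi|\leqslant l_1\,o(1)$.
   Formalization: The empty configuration μ = 0 is excluded, also in the estimate defining C (there l_1 = 0 while the two probabilities are 1 and e^{-(1-q_1)t}), and A is assumed to have finite Lebesgue measure, since C(1_A) is defined only for 1_A in L^1. *)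

(* Defs.v *)
From HB Require Import structures.
From mathcomp Require Import all_boot all_order all_algebra.
From mathcomp Require Import finmap multiset.
From mathcomp Require Import all_classical all_reals all_analysis.
From mathcomp Require Import lra.

Set Implicit Arguments.
Unset Strict Implicit.
Unset Printing Implicit Defensive.

Import Order.TTheory GRing.Theory Num.Theory.
Import numFieldNormedType.Exports.

Local Open Scope classical_set_scope.
Local Open Scope ring_scope.

Notation borel T := (g_sigma_algebraType (@open T)).

(* The sigma-finite image of m by an injection f with measurable left inverse. *)
Section iso_image.
Context d1 d2 (T1 : measurableType d1) (T2 : measurableType d2) (R : realType).
Variables (m : {sigma_finite_measure set T1 -> \bar R}).
Variables (f : T1 -> T2) (g : T2 -> T1).
Hypotheses (mf : measurable_fun [set: T1] f) (mg : measurable_fun [set: T2] g).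
Hypothesis fK : cancel f g.

Definition iso_image_def of measurable_fun [set: T1] f
    & measurable_fun [set: T2] g & cancel f g : set T2 -> \bar R :=
  pushforward m f.

Let nu := iso_image_def mf mg fK.

Let nu0 : nu set0 = 0%E.
Proof. by rewrite /nu /iso_image_def /pushforward preimage_set0 measure0. Qed.

Let nu_ge0 A : (0 <= nu A)%E.
Proof. exact: measure_ge0. Qed.

Let nu_sigma_additive : semi_sigma_additive nu.
Proof.
move=> F mF tF mUF; rewrite /nu /iso_image_def /pushforward preimage_bigcup.
apply: measure_semi_sigma_additive.
- by move=> n; rewrite -[X in measurable X]setTI; exact: mf.
- apply/trivIsetP => /= i j _ _ ij; rewrite -preimage_setI.
  by move/trivIsetP : tF => /(_ _ _ _ _ ij) ->//; rewrite preimage_set0.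
- by rewrite -preimage_bigcup -[X in measurable X]setTI; exact: mf.
Qed.

HB.instance Definition _ := isMeasure.Build _ _ _ nu nu0 nu_ge0 nu_sigma_additive.

Let nu_sigma_finite : sigma_finite [set: T2] nu.
Proof.
have [F TF Foo] := sigma_finiteT m.
exists (fun i => g @^-1` F i) => [|i].
  by rewrite -preimage_bigcup -TF preimage_setT.
split; first by rewrite -[X in measurable X]setTI; apply: mg => //; have [] := Foo i.
rewrite /nu /iso_image_def /pushforward (_ : f @^-1` _ = F i); first by have [] := Foo i.
by apply/seteqP; split => x /=; rewrite fK.
Qed.

HB.instance Definition _ := Measure_isSigmaFinite.Build _ _ _ nu nu_sigma_finite.

Definition iso_image : {sigma_finite_measure set T2 -> \bar R} := nu.

End iso_image.

Section sigma_finite_product.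
Context d1 d2 (T1 : measurableType d1) (T2 : measurableType d2) (R : realType).
Variables (m1 : {sigma_finite_measure set T1 -> \bar R})
          (m2 : {sigma_finite_measure set T2 -> \bar R}).

Definition sigma_finite_product_def : set (T1 * T2) -> \bar R := (m1 \x m2)%E.

HB.instance Definition _ := Measure.on sigma_finite_product_def.

Let sigma_finite_productT : sigma_finite setT sigma_finite_product_def.
Proof.
have /sigma_finiteP[F [TF ndF Foo]] := sigma_finiteT m1.
have /sigma_finiteP[G [TG ndG Goo]] := sigma_finiteT m2.
exists (fun n => F n `*` G n).
  rewrite -setXTT TF TG predeqE => -[x y]; split.
    move=> [/= [n _ Fnx] [k _ Gky]]; exists (maxn n k) => //; split.
    - by move: x Fnx; exact/subsetPset/ndF/leq_maxl.
    - by move: y Gky; exact/subsetPset/ndG/leq_maxr.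
  by move=> [n _ []/= ? ?]; split; exists n.
move=> k; have [? ?] := Foo k; have [? ?] := Goo k.
split; first exact: measurableX.
by rewrite /sigma_finite_product_def product_measure1E// lte_mul_pinfty// ge0_fin_numE.
Qed.

HB.instance Definition _ := Measure_isSigmaFinite.Build _ _ _
  sigma_finite_product_def sigma_finite_productT.

Definition sigma_finite_product :
    {sigma_finite_measure set (T1 * T2)%type -> \bar R} :=
  sigma_finite_product_def.

End sigma_finite_product.

Section lebesgue_tuple.
Context (R : realType).
Let T := measurableTypeR R.

Definition cons_pair n (p : T * n.-tuple T) : n.+1.-tuple T :=
  [the n.+1.-tuple T of p.1 :: p.2].

Definition uncons n (t : n.+1.-tuple T) : T * n.-tuple T :=
  (thead t, [tuple of behead t]).

Lemma measurable_cons_pair n :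
  measurable_fun [set: T * n.-tuple T] (@cons_pair n).
Proof. exact: measurable_cons. Qed.

Lemma measurable_uncons n : measurable_fun [set: n.+1.-tuple T] (@uncons n).
Proof.
apply: measurable_fun_pair => /=.
  exact: (@measurable_tnth _ T n.+1 ord0).
exact: measurable_behead.
Qed.

Lemma cons_pairK n : cancel (@cons_pair n) (@uncons n).
Proof.
move=> [x t]; rewrite /uncons /cons_pair /=; congr pair.
exact: val_inj.
Qed.

Definition dirac_nil : {sigma_finite_measure set (0.-tuple T) -> \bar R} :=
  \d_([tuple] : 0.-tuple T).

Fixpoint lebesgue_tuple n : {sigma_finite_measure set (n.-tuple T) -> \bar R} :=
  match n with
  | 0 => dirac_nil
  | n.+1 => iso_image (sigma_finite_product (@lebesgue_measure R) (lebesgue_tuple n))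
              (@measurable_cons_pair n) (@measurable_uncons n) (@cons_pairK n)
  end.

End lebesgue_tuple.

Section lebesgue_mx.
Context (R : realType) (m n : nat).
Let T := measurableTypeR R.

Definition mx_of_tuple (t : (m * n).-tuple T) : 'M[R]_(m, n) :=
  \matrix_(i, j) tnth t (mxvec_index i j).

Definition tuple_of_mx (x : 'M[R]_(m, n)) : (m * n).-tuple T :=
  [tuple mxvec x 0 k | k < m * n].

Lemma mx_of_tupleK : cancel mx_of_tuple tuple_of_mx.
Proof.
move=> t; apply: eq_from_tnth => k; rewrite tnth_mktuple.
by case/mxvec_indexP: k => i j; rewrite mxvecE mxE.
Qed.

Lemma measurable_mx_of_tuple :
  measurable_fun setT (mx_of_tuple : _ -> borel 'M[R]_(m, n)).
Proof.
apply: (@measurability _ _ _ (borel 'M[R]_(m, n)) _ _ (@open 'M[R]_(m, n))) => //.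
move=> _ [U oU <-]; rewrite setTI.
pose box (ab : 'M[rat]_(m, n) * 'M[rat]_(m, n)) : set 'M[R]_(m, n) :=
  [set x | forall i j, ratr (ab.1 i j) < x i j < ratr (ab.2 i j)].
have mbox ab : measurable (mx_of_tuple @^-1` box ab).
  rewrite (_ : _ @^-1` _ = \bigcap_(ij in [set: 'I_m * 'I_n])
    ((fun t => tnth t (mxvec_index ij.1 ij.2)) @^-1`
      `]ratr (ab.1 ij.1 ij.2), ratr (ab.2 ij.1 ij.2)[%classic)); last first.
    apply/seteqP; split => [t bt [i j] _|t bt i j] /=.
      by rewrite in_itv/=; have := bt i j; rewrite mxE.
    by have := bt (i, j) Logic.I; rewrite /= in_itv/= mxE.
  apply: fin_bigcap_measurable => // ij _; rewrite -[X in measurable X]setTI.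
  by apply: measurable_tnth => //; exact: measurable_itv.
rewrite (_ : _ @^-1` U = \bigcup_ab
  (mx_of_tuple @^-1` (box ab `&` [set x | box ab `<=` U]))); last first.
  apply/seteqP; split => [t Ut|t [ab _ [/= bt]]]; last exact.
  have /nbhs_ballP[e e0 beU] : nbhs (mx_of_tuple t) U by exact: open_nbhs_nbhs.
  pose x := mx_of_tuple t.
  have /(_ _ _)/cid ex1 i j : exists q : rat, x i j - e < ratr q < x i j.
    have /rat_in_itvoo[q] : x i j - e < x i j by rewrite ltrBlDr ltrDl.
    by rewrite in_itv/= => qx; exists q.
  have /(_ _ _)/cid ex2 i j : exists q : rat, x i j < ratr q < x i j + e.
    have /rat_in_itvoo[q] : x i j < x i j + e by rewrite ltrDl.
    by rewrite in_itv/= => qx; exists q.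
  exists (\matrix_(i, j) sval (ex1 i j), \matrix_(i, j) sval (ex2 i j)) => //.
  split => [i j /=|y /= ybox].
    rewrite !mxE; case: (ex1 i j) => q1 /= /andP[_ ->].
    by case: (ex2 i j) => q2 /= /andP[-> _].
  apply: beU; split => // i j; have := ybox i j; rewrite /= !mxE.
  rewrite /ball /= /ball_/=.
  case: (ex1 i j) => q1 /= /andP[xq1 _]; case: (ex2 i j) => q2 /= /andP[_ q2x].
  move=> /andP[q1y yq2]; rewrite ltr_norml.
  have y1 := lt_trans xq1 q1y; have y2 := lt_trans yq2 q2x.
  rewrite /x mxE in y1 y2; apply/andP; split; lra.
apply: countable_bigcupT_measurable => [|ab]; first exact: countableP.
rewrite preimage_setI; have [bU|bU] := pselect (box ab `<=` U).
  by rewrite [X in _ `&` X](_ : _ = setT) ?setIT//; apply/seteqP; split.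
rewrite [X in _ `&` X](_ : _ = set0) ?setI0//.
by apply/seteqP; split.
Qed.

Lemma measurable_tuple_of_mx :
  measurable_fun setT (tuple_of_mx : borel 'M[R]_(m, n) -> _).
Proof.
apply/measurable_fun_tnthP => k; case/mxvec_indexP: k => i j.
rewrite (_ : _ \o _ = fun x : 'M[R]_(m, n) => x i j); last first.
  by apply/funext => x /=; rewrite tnth_mktuple mxvecE.
apply: (@measurability _ _ _ _ _ _ (@measurable_realfun.RGenOInfty.G R)).
  exact: measurable_realfun.RGenOInfty.measurableE.
move=> _ [_ [x ->] <-]; rewrite setTI; apply: sub_sigma_algebra.
apply: open_comp; last exact: interval_open.
by move=> y _; exact: coord_continuous.
Qed.

(* Lebesgue measure on m x n matrices, i.e. on R^(m * n). *)
Definition lebesgue_mx :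
    {sigma_finite_measure set (borel 'M[R]_(m, n)) -> \bar R} :=
  iso_image (lebesgue_tuple R (m * n))
    measurable_mx_of_tuple measurable_tuple_of_mx mx_of_tupleK.

End lebesgue_mx.

Section configurations.
Context (R : realType) (d : nat).

(* A finite sum of Dirac measures is encoded by the multiset of its atoms. *)
Definition conf := ({mset 'rV[R]_d})%mset.

HB.instance Definition _ := Choice.on conf.
HB.instance Definition _ := isPointed.Build conf mset0.

Definition zero_conf : conf := mset0.

Definition add_conf (mu nu : conf) : conf := msetD mu nu.

Definition l1 (mu : conf) : nat := size (enum_mset mu).

(* The row-major identification of E^k with k x d matrices, followed by the
   quotient map onto the symmetric power E^(k). *)
Definition conf_of_mx k (x : 'M[R]_(k, d)) : conf :=
  seq_mset [seq row i x | i <- enum 'I_k].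

(* Disjoint union, over k, of the quotient topologies of the E^(k). *)
Definition open_conf : set (set conf) :=
  [set G | forall k, open [set x : 'M[R]_(k, d) | G (conf_of_mx x)]].

Let open_confT : open_conf setT.
Proof. by move=> k; exact: openT. Qed.

Let open_confI (G1 G2 : set conf) :
  open_conf G1 -> open_conf G2 -> open_conf (G1 `&` G2).
Proof. by move=> oG1 oG2 k; exact: openI (oG1 k) (oG2 k). Qed.

Let open_conf_bigcup (I : Type) (f : I -> set conf) :
  (forall i, open_conf (f i)) -> open_conf (\bigcup_i f i).
Proof.
move=> of_ k; have := @bigcup_open _ _ setT _ (fun i _ => of_ i k).
by congr open; apply/seteqP; split.
Qed.

HB.instance Definition _ := isOpenTopological.Build conf
  open_confT open_confI open_conf_bigcup.

Definition hat (psi : 'rV[R]_d -> R) (mu : conf) : R :=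
  \prod_(x <- enum_mset mu) psi x.

Definition hat_set (A : set 'rV[R]_d) : set conf :=
  [set mu | forall x, x \in mu -> A x].

End configurations.

Section heat.
Context (R : realType) (d : nat).

Definition heat_kernel (t : R) (z : 'rV[R]_d) : R :=
  (4 * pi * t) `^ (- (d%:R / 2)) *
  expR (- (\sum_(i < d) z 0 i ^+ 2) / (4 * t)).

Definition heat (t : R) (phi : 'rV[R]_d -> R) (x : 'rV[R]_d) : R :=
  if t == 0 then phi x
  else \int[lebesgue_mx R 1 d]_y (heat_kernel t (x - y) * phi y).

(* For t > 0 this is the expectation of F at the configuration of k independent
   Brownian motions at time t started from the atoms of mu (k = l1 mu); composing
   F with conf_of_mx is the symmetrization, and the order in which enum_mset
   lists the atoms is immaterial. *)
Definition conf_heat (t : R) (F : conf R d -> R) (mu : conf R d) : R :=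
  if t == 0 then F mu
  else \int[lebesgue_mx R (l1 mu) d]_y
    ((\prod_(i < l1 mu) heat_kernel t (nth 0 (enum_mset mu) i - row i y))
     * F (conf_of_mx y)).

(* The transition function exp(- c t) P_t of the c-subprocess, on sets. *)
Definition subprocess_transition (c t : R) (mu : conf R d)
    (G : set (conf R d)) : \bar R :=
  (expR (- (c * t)) * conf_heat t \1_G mu)%:E.

End heat.

Section markov.
Context (R : realType) dT (T : measurableType dT).

Definition transition_function (Q : R -> R.-pker T ~> T) : Prop :=
  (forall x G, measurable G -> Q 0 x G = \d_x G) /\
  (forall s t x G, 0 <= s -> 0 <= t -> measurable G ->
     Q (s + t) x G = (\int[Q s x]_y Q t y G)%E).

Context dO (Omega : measurableType dO).
Implicit Types X : R -> Omega -> option T.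

(* None is the cemetery. *)
Definition alive_in X t (G : set T) : set Omega := X t @^-1` (Some @` G).

Definition past X s : set (set Omega) :=
  <<s [set F | exists r G,
    [/\ 0 <= r <= s, measurable G & F = alive_in X r G]] >>.

Definition markov_process (Q : R -> T -> set T -> \bar R)
    (P : T -> probability Omega R) X : Prop :=
  [/\ forall t G, 0 <= t -> measurable G -> measurable (alive_in X t G),
      forall x, P x [set w | X 0 w = Some x] = 1%E &
      forall x s t G F, 0 <= s -> 0 <= t -> measurable G -> past X s F ->
        P x (F `&` alive_in X (s + t) G) =
        (\int[P x]_(w in F) (if X s w is Some y then Q t y G else 0))%E].

End markov.

Section branching.
Context (R : realType) (d : nat) (q : nat -> R).

(* The value q 0 is never used. *)
Definition reaction (r : R) : R :=
  - r + limn (fun n => \sum_(1 <= k < n) q k * r ^+ k).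

Definition mild_solution (phi : 'rV[R]_d -> R) (u : R -> 'rV[R]_d -> R) : Prop :=
  [/\ measurable_fun
        [set tx : (measurableTypeR R * borel 'rV[R]_d)%type | (0 : R) <= tx.1]
        (fun tx => u tx.1 tx.2),
      forall t x, 0 <= t -> 0 <= u t x <= 1,
      forall x, u 0 x = phi x &
      forall t x, 0 < t -> u t x = heat t phi x +
        \int[@lebesgue_measure R]_(s in `[0, t])
          heat (t - s) (fun y => reaction (u s y)) x].

Definition branching_semigroup
    (H : R -> R.-pker (borel (conf R d)) ~> (borel (conf R d))) : Prop :=
  forall phi : borel 'rV[R]_d -> R, measurable_fun setT phi ->
    (forall x, 0 <= phi x <= 1) ->
    exists2 u, mild_solution phi u &
      forall t (mu : conf R d), 0 <= t ->
        \int[H t mu]_nu hat phi nu = hat (u t) mu.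

(* Equality of the finite-dimensional distributions of X under P (mu1 + mu2)
   with those of the sum of independent copies under P mu1 and P mu2. *)
Definition branching_property dO (Omega : measurableType dO)
    (P : conf R d -> probability Omega R) (X : R -> Omega -> conf R d) : Prop :=
  forall (mu1 mu2 : conf R d) n (t : 'I_n -> R) (G : 'I_n -> set (borel (conf R d))),
    (forall i, 0 <= t i) -> (forall i, measurable (G i)) ->
    P (add_conf mu1 mu2) [set w | forall i, G i (X (t i) w)] =
    (P mu1 \x P mu2)%E
      [set w | forall i, G i (add_conf (X (t i) w.1) (X (t i) w.2))].

Definition branching_process dO (Omega : measurableType dO)
    (H : R -> R.-pker (borel (conf R d)) ~> (borel (conf R d)))
    (P : conf R d -> probability Omega R) (X : R -> Omega -> conf R d) : Prop :=
  [/\ transition_function H,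
      branching_semigroup H,
      markov_process (T := borel (conf R d)) (fun t mu => H t mu) P
        (fun t w => Some (X t w)) &
      branching_property P X].

Definition uniform_o1 (eps : conf R d -> R -> R) : Prop :=
  forall e, 0 < e -> \forall t \near +oo, forall mu, `|eps mu t| <= e.

(* No real c satisfies the bound at mu = 0: there l1 = 0, whereas
   H_t hat(phi) = P_t hat(phi) = hat(c) = 1 and q 1 < 1. *)
Definition asymptotic_constant
    (H : R -> R.-pker (borel (conf R d)) ~> (borel (conf R d)))
    (phi : 'rV[R]_d -> R) (c : R) : Prop :=
  0 < c /\ exists2 eps, uniform_o1 eps &
    forall (mu : conf R d) t, mu <> zero_conf R d -> 0 < t ->
      t `^ (d%:R / 2) *
        `|expR (t * (1 - q 1)) * \int[H t mu]_nu hat phi nu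
          - hat (cst c) mu * conf_heat t (hat phi) mu|
      <= (l1 mu)%:R * eps mu t.

(* Unique when phi is not a.e. zero; some admissible value otherwise. *)
Definition asymptotic_C
    (H : R -> R.-pker (borel (conf R d)) ~> (borel (conf R d)))
    (phi : 'rV[R]_d -> R) : R :=
  get (asymptotic_constant H phi).

End branching.

(* Main.v *)
Require Import Defs.
From mathcomp Require Import all_boot all_order all_algebra.
From mathcomp Require Import finmap multiset.
From mathcomp Require Import all_classical all_reals all_analysis.
From mathcomp Require Import measurable_realfun lra.

Set Implicit Arguments.
Unset Strict Implicit.
Unset Printing Implicit Defensive.

Import Order.TTheory GRing.Theory Num.Theory.
Import numFieldNormedType.Exports.

Local Open Scope classical_set_scope.
Local Open Scope ring_scope.

(** Write lam = 1 - q_1, P_t for the heat semigroup and phi for the indicator of [A].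
    The reaction is - lam r + g(r) with 0 <= g(r) <= lam r^2 on the unit interval
    ([reaction_ge], [reaction_le]): g collects the branchings into several particles.

    By the Markov property the two probabilities are values of transition functions, and
    at a configuration with atoms x_1, ..., x_n these are the product of the u(t, x_i),
    with u the mild solution started from phi, and exp (- lam t) times the product of the
    P_t phi(x_i) ([markov_marginal], [conf_heat_hat]). The claim is then the inequality that
    characterizes the asymptotic constant, so the theorem amounts to the existence of such
    a constant ([asymptotic_constant_exists]).

    For one particle, fix (t, x) and follow psi(s) = P_{t-s} u(s)(x), which goes from
    P_t phi(x) to u(t, x). By Duhamel's formula ([duhamel]) psi decreases at the rate
    lam psi - P_{t-s} g(u(s))(x), a scalar balance that can be multiplied by exponentials
    ([exp_weight_eq]). First, u <= P_t phi = O(t^{-d/2}), so u is eventually at most 1/4;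
    from then on psi decreases at a rate at least 3/4 lam psi, and u(t) is at most
    C exp (- 3/4 lam t) P_t phi ([exp_u_decay]). Since g(u) is quadratic in u and
    2 * 3/4 > 1, exp (lam t) u(t) then differs from exp (lam T) P_{t-T} u(T) by at most
    2 C^2 exp (- lam T / 2) P_t phi, uniformly in t >= T ([exp_u_increment]).

    Integrating over space, the masses exp (lam T) int u(T) converge to a limit m
    ([exp_mass_cvg]). For fixed T, P_{t-T} u(T) and P_t phi = P_{t-T} (P_T phi) are both
    heat flows of integrable functions, and such a flow is its mass times the heat kernel
    up to o(t^{-d/2}) uniformly in space ([heat_spreading]). Letting t and then T tend to
    infinity gives exp (lam t) u(t) = c P_t phi + o(t^{-d/2}) with c = m / int phi
    ([exp_u_asymptotics]).

    For n >= 2 particles both products are O(t^{-nd/2}), which is negligible after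
    multiplication by t^{d/2} ([exp_prod_u_asymptotics]). *)

(** * Measurability of matrices and Tonelli's theorem for tuples *)

Section measurable_matrix.
Context (R : realType) (m n : nat).

Lemma measurable_coord (i : 'I_m) (j : 'I_n) :
  measurable_fun setT (fun x : borel 'M[R]_(m, n) => x i j).
Proof.
have -> : (fun x : borel 'M[R]_(m, n) => x i j) =
    (fun t => tnth t (mxvec_index i j)) \o @tuple_of_mx R m n.
  by apply/funext => x /=; rewrite tnth_mktuple mxvecE.
by apply: measurableT_comp; [exact: measurable_tnth|exact: measurable_tuple_of_mx].
Qed.

(** A matrix is the image of the tuple of its entries under [mx_of_tuple], so only the
    entries have to be checked. *)
Lemma measurable_mx d (X : measurableType d) (f : X -> 'M[R]_(m, n)) :
  (forall i j, measurable_fun setT (fun x => f x i j)) ->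
  measurable_fun setT (f : X -> borel 'M[R]_(m, n)).
Proof.
move=> mf.
have -> : f = @mx_of_tuple R m n \o
    (fun x => [tuple f x (enum_val (cast_ord (esym (mxvec_cast m n)) k)).1
                  (enum_val (cast_ord (esym (mxvec_cast m n)) k)).2 | k < m * n]).
  apply/funext => x; apply/matrixP => i j /=.
  by rewrite mxE tnth_mktuple cast_ordK enum_rankK.
apply: measurableT_comp; first exact: measurable_mx_of_tuple.
apply/measurable_fun_tnthP => k.
set i := cast_ord (esym (mxvec_cast m n)) k.
rewrite (_ : _ \o _ = fun x => f x (enum_val i).1 (enum_val i).2); first exact: mf.
by apply/funext => x /=; rewrite tnth_mktuple.
Qed.

End measurable_matrix.

Lemma index_allpairs (S T : eqType) (s : seq S) (t : seq T) x y :
  x \in s -> y \in t ->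
  index (x, y) [seq (a, b) | a <- s, b <- t] = (index x s * size t + index y t)%N.
Proof.
elim: s => // a s IH; rewrite inE => xs yt /=.
rewrite index_cat; case: (eqVneq a x) xs => [->|ax] /= xs.
  rewrite map_f // mul0n add0n.
  by apply: (index_map (f := pair x)) => b c [].
case: ifP => [/mapP[b _ [/eqP]]|_]; first by rewrite eq_sym (negbTE ax).
by rewrite size_map IH // mulSn addnA.
Qed.

(** Lebesgue measure on matrices is transported from tuples along [mxvec_index], which is
    defined through an enumeration of pairs. The row-major formula identifies the first row
    of a matrix with the initial segment of its tuple. *)
Lemma val_mxvec_index m n (i : 'I_m) (j : 'I_n) :
  mxvec_index i j = (i * n + j)%N :> nat.
Proof.
have -> : mxvec_index i j = index (i, j) (enum {: 'I_m * 'I_n}) :> nat.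
  rewrite /= /enum_rank [enum_rank_in]unlock /= insubdK //.
  by rewrite -topredE /= cardE index_mem mem_enum.
rewrite enumT unlock /= /prod_enum index_allpairs ?mem_enum //.
by rewrite !index_enum_ord size_enum_ord.
Qed.

Section integral_lebesgue_tuple.
Context (R : realType).
Local Open Scope ereal_scope.
Local Notation T := (measurableTypeR R).

Lemma ge0_integral_lebesgue_tupleS n (F : n.+1.-tuple T -> \bar R) :
  measurable_fun setT F -> (forall t, 0 <= F t) ->
  \int[lebesgue_tuple R n.+1]_t F t =
  \int[@lebesgue_measure R]_x \int[lebesgue_tuple R n]_t F (cons_pair (x, t)).
Proof.
move=> mF F0; rewrite [LHS](@ge0_integral_pushforward _ _ _ _ R
  (@cons_pair R n) (@measurable_cons_pair R n)
  (sigma_finite_product (@lebesgue_measure R) (lebesgue_tuple R n)) setT F) //.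
rewrite preimage_setT (fubini_tonelli1 (F \o @cons_pair R n)) //.
  exact: measurableT_comp mF (@measurable_cons_pair R n).
by move=> p; exact: F0.
Qed.

Lemma measurable_cat_tuple a b :
  measurable_fun setT (fun p : a.-tuple T * b.-tuple T => cat_tuple p.1 p.2).
Proof.
apply/measurable_fun_tnthP => k.
case: (split_ordP k) => j ->.
  rewrite (_ : _ \o _ = (fun t => tnth t j) \o fst).
    by apply: measurableT_comp => //; exact: measurable_tnth.
  by apply/funext => p /=; rewrite tnth_lshift.
rewrite (_ : _ \o _ = (fun t => tnth t j) \o snd).
  by apply: measurableT_comp => //; exact: measurable_tnth.
by apply/funext => p /=; rewrite tnth_rshift.
Qed.

Lemma measurable_integral_cat_tuple a b (F : (a + b).-tuple T -> \bar R) :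
  measurable_fun setT F -> (forall t, 0 <= F t) ->
  measurable_fun [set: a.-tuple T]
    (fun s => \int[lebesgue_tuple R b]_t F (cat_tuple s t)).
Proof.
move=> mF F0.
have := @measurable_fun_fubini_tonelli_F _ _ _ _ R (lebesgue_tuple R b)
  (F \o (fun p : a.-tuple T * b.-tuple T => cat_tuple p.1 p.2))
  (measurableT_comp mF (@measurable_cat_tuple a b)).
by apply=> p; exact: F0.
Qed.

(** Induction on the length of the first piece, peeling off one coordinate at a time with
    Tonelli's theorem. *)
Lemma ge0_integral_lebesgue_tupleD a b (F : (a + b).-tuple T -> \bar R) :
  measurable_fun setT F -> (forall t, 0 <= F t) ->
  \int[lebesgue_tuple R (a + b)]_t F t =
  \int[lebesgue_tuple R a]_s \int[lebesgue_tuple R b]_t F (cat_tuple s t).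
Proof.
elim: a F => [|a IH] F mF F0.
  rewrite [RHS]integral_dirac //; last first.
    exact: measurable_integral_cat_tuple.
  rewrite /= diracT mul1e; apply: eq_integral => t _; congr F.
  exact: val_inj.
have mFc : measurable_fun setT (fun p : T * (a + b).-tuple T => F (cons_pair p)).
  exact: measurableT_comp mF (@measurable_cons_pair R _).
transitivity (\int[@lebesgue_measure R]_x \int[lebesgue_tuple R (a + b)]_t
    F (cons_pair (x, t))); first exact: ge0_integral_lebesgue_tupleS.
rewrite ge0_integral_lebesgue_tupleS; last 2 first.
  - exact: measurable_integral_cat_tuple.
  - by move=> t; apply: integral_ge0.
apply: eq_integral => x _; rewrite IH //; last first.
  exact: measurableT_comp mFc (pair1_measurable x).
apply: eq_integral => s _; apply: eq_integral => t _; congr F.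
exact: val_inj.
Qed.

Lemma integral_lebesgue_tuple_tcast a b (e : a = b) (F : b.-tuple T -> \bar R) :
  \int[lebesgue_tuple R b]_t F t = \int[lebesgue_tuple R a]_t F (tcast e t).
Proof. by case: b / e F. Qed.

(** The factors are indexed by [nat], so that the induction on [n] shifts them without
    casts between ordinal types. *)
Lemma integral_lebesgue_tuple_prod n (f : nat -> R -> R) (I : nat -> R) :
  (forall i, measurable_fun setT (f i : T -> R)) -> (forall i x, (0 <= f i x)%R) ->
  (forall i, \int[@lebesgue_measure R]_x (f i x)%:E = (I i)%:E) ->
  \int[lebesgue_tuple R n]_t (\prod_(i < n) f i (tnth t i))%:E =
  (\prod_(i < n) I i)%:E.
Proof.
move=> mf f0 fI.
elim: n f I mf f0 fI => [|n IH] f I mf f0 fI.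
  rewrite big_ord0; under eq_integral do rewrite big_ord0.
  by rewrite integral_cst //= diracT mule1.
rewrite ge0_integral_lebesgue_tupleS; last 2 first.
- apply/measurable_EFinP; apply: measurable_prod => i _.
  by apply: measurableT_comp; [exact: mf|exact: measurable_tnth].
- by move=> t; rewrite lee_fin; apply: prodr_ge0.
have I0 i : (0 <= I i)%R.
  by rewrite -lee_fin -fI; apply: integral_ge0 => x _; rewrite lee_fin.
transitivity (\int[@lebesgue_measure R]_x
    ((f 0%N x)%:E * (\prod_(i < n) I i.+1)%:E)); last first.
  rewrite ge0_integralZr //.
  - by rewrite fI big_ord_recl -EFinM.
  - by apply/measurable_EFinP.
  - by move=> x _; rewrite lee_fin.
  - by rewrite lee_fin prodr_ge0.
apply: eq_integral => x _.
rewrite -(IH (fun i => f i.+1) (fun i => I i.+1)) // -ge0_integralZl //.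
- apply: eq_integral => t _; rewrite -EFinM; congr EFin.
  rewrite big_ord_recl; congr (_ * _)%R.
  by apply: eq_bigr => i _; rewrite tnthS.
- apply/measurable_EFinP; apply: measurable_prod => i _.
  by apply: measurableT_comp; [exact: mf|exact: measurable_tnth].
- by move=> t _; rewrite lee_fin prodr_ge0.
- by rewrite lee_fin.
Qed.

End integral_lebesgue_tuple.

(** * Lebesgue measure on matrices, row by row *)

Section integral_lebesgue_mx.
Context (R : realType).
Local Open Scope ereal_scope.

Lemma ge0_integral_lebesgue_mx k d (F : borel 'M[R]_(k, d) -> \bar R) :
  measurable_fun setT F -> (forall x, 0 <= F x) ->
  \int[lebesgue_mx R k d]_x F x =
  \int[lebesgue_tuple R (k * d)]_t F (mx_of_tuple t).
Proof.
move=> mF F0; rewrite [LHS](@ge0_integral_pushforward _ _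
  ((k * d).-tuple (measurableTypeR R)) (borel 'M[R]_(k, d)) R
  (@mx_of_tuple R k d) (@measurable_mx_of_tuple R k d)
  (lebesgue_tuple R (k * d)) setT F) //.
Qed.

Lemma measurable_row k d (i : 'I_k) :
  measurable_fun setT (row i : borel 'M[R]_(k, d) -> borel 'rV[R]_d).
Proof.
apply: measurable_mx => a j.
rewrite (_ : (fun x => _) = fun x : borel 'M[R]_(k, d) => x i j).
  exact: measurable_coord.
by apply/funext => x; rewrite mxE.
Qed.

Lemma measurable_col_mx k d :
  measurable_fun setT (fun p : borel 'rV[R]_d * borel 'M[R]_(k, d) =>
    col_mx p.1 p.2 : borel 'M[R]_(1 + k, d)).
Proof.
apply: measurable_mx => i j; case: (split_ordP i) => a ->.
  rewrite (_ : (fun x => _) = (fun x : borel 'rV[R]_d => x a j) \o fst).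
    by apply: measurableT_comp => //; exact: measurable_coord.
  by apply/funext => x /=; rewrite col_mxEu.
rewrite (_ : (fun x => _) = (fun x : borel 'M[R]_(k, d) => x a j) \o snd).
  by apply: measurableT_comp => //; exact: measurable_coord.
by apply/funext => x /=; rewrite col_mxEd.
Qed.

(** In row-major order the first row is an initial segment of the tuple of entries. The cast
    in the proof is due to [1 * d] and [d] being equal but not convertible. *)
Lemma ge0_integral_lebesgue_mxS k d (F : borel 'M[R]_(1 + k, d) -> \bar R) :
  measurable_fun setT F -> (forall x, 0 <= F x) ->
  \int[lebesgue_mx R (1 + k) d]_x F x =
  \int[lebesgue_mx R 1 d]_x \int[lebesgue_mx R k d]_y F (col_mx x y).
Proof.
move=> mF F0.
rewrite (ge0_integral_lebesgue_mx mF F0).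
rewrite (@ge0_integral_lebesgue_mx 1 d); last 2 first.
- have := @measurable_fun_fubini_tonelli_F _ _ _ _ R (lebesgue_mx R k d)
    (F \o (fun p : borel 'rV[R]_d * borel 'M[R]_(k, d) => col_mx p.1 p.2))
    (measurableT_comp mF (@measurable_col_mx k d)).
  by apply=> p; exact: F0.
- by move=> x; apply: integral_ge0 => y _; exact: F0.
rewrite (integral_lebesgue_tuple_tcast (esym (mul1n d))).
have mFm : measurable_fun setT (F \o @mx_of_tuple R (1 + k) d).
  exact: measurableT_comp mF (@measurable_mx_of_tuple R (1 + k) d).
rewrite (@ge0_integral_lebesgue_tupleD R d (k * d) (F \o @mx_of_tuple R (1 + k) d)) //; last first.
  by move=> t; exact: F0.
apply: eq_integral => s _.
rewrite (@ge0_integral_lebesgue_mx k d); last 2 first.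
- have mc := measurableT_comp mF (@measurable_col_mx k d).
  exact: measurableT_comp mc (pair1_measurable _).
- by move=> x; exact: F0.
apply: eq_integral => t _ /=; congr F.
apply/matrixP => i j; rewrite mxE (tnth_nth 0%R) val_mxvec_index /= nth_cat size_tuple.
case: (split_ordP i) => a ->.
  rewrite col_mxEu mxE (tnth_nth 0%R) val_mxvec_index /= !ord1 /= mul0n add0n ltn_ord.
  by rewrite val_tcast.
rewrite col_mxEd mxE (tnth_nth 0%R) val_mxvec_index /= mulnDl mul1n -addnA.
by rewrite ltnNge leq_addr /= addKn.
Qed.

(** The rows of a matrix are independent coordinates of Lebesgue measure; this is what turns
    independent motion of the particles into a product. *)
Lemma integral_lebesgue_mx_rows k d (G : nat -> 'rV[R]_d -> R) (I : nat -> R) :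
  (forall i, measurable_fun setT (G i : borel 'rV[R]_d -> R)) ->
  (forall i x, (0 <= G i x)%R) ->
  (forall i, \int[lebesgue_mx R 1 d]_x (G i x)%:E = (I i)%:E) ->
  \int[lebesgue_mx R k d]_x (\prod_(i < k) G i (row i x))%:E =
  (\prod_(i < k) I i)%:E.
Proof.
elim: k G I => [|k IH] G I mG G0 GI.
  rewrite big_ord0; under eq_integral do rewrite big_ord0.
  rewrite ge0_integral_lebesgue_mx //.
  have := @integral_cst _ _ R (lebesgue_tuple R 0) setT measurableT 1.
  by rewrite /= diracT mule1.
rewrite (@ge0_integral_lebesgue_mxS k d); last 2 first.
- apply/measurable_EFinP; apply: measurable_prod => i _.
  exact: measurableT_comp (mG i) (@measurable_row k.+1 d i).
- by move=> t; rewrite lee_fin; apply: prodr_ge0.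
have I0 i : (0 <= I i)%R.
  by rewrite -lee_fin -GI; apply: integral_ge0 => x _; rewrite lee_fin.
transitivity (\int[lebesgue_mx R 1 d]_x
    ((G 0%N x)%:E * (\prod_(i < k) I i.+1)%:E)); last first.
  rewrite ge0_integralZr //.
  - by rewrite GI big_ord_recl -EFinM.
  - by apply/measurable_EFinP.
  - by move=> x _; rewrite lee_fin.
  - by rewrite lee_fin prodr_ge0.
apply: eq_integral => x _.
rewrite -(IH (fun i => G i.+1) (fun i => I i.+1)) // -ge0_integralZl //.
- apply: eq_integral => y _; rewrite -EFinM; congr EFin.
  rewrite big_ord_recl; congr (_ * _)%R.
    congr (G _ _); apply/rowP => j; rewrite mxE.
    have -> : ord0 = lshift k (ord0 : 'I_1) by exact: val_inj.
    by rewrite (@col_mxEu _ 1 k d x y ord0 j).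
  apply: eq_bigr => i _; congr (G _ _); apply/rowP => j; rewrite mxE [RHS]mxE.
  have -> : lift ord0 i = rshift 1 i by exact: val_inj.
  by rewrite (@col_mxEd _ 1 k d x y i j).
- apply/measurable_EFinP; apply: measurable_prod => i _.
  exact: measurableT_comp (mG _) (@measurable_row k d i).
- by move=> t _; rewrite lee_fin prodr_ge0.
- by rewrite lee_fin.
Qed.

Lemma integral_lebesgue_rV_prod d (f : nat -> R -> R) (I : nat -> R) :
  (forall i, measurable_fun setT (f i)) -> (forall i x, (0 <= f i x)%R) ->
  (forall i, \int[@lebesgue_measure R]_x (f i x)%:E = (I i)%:E) ->
  \int[lebesgue_mx R 1 d]_x (\prod_(j < d) f j (x 0%R j))%:E =
  (\prod_(j < d) I j)%:E.
Proof.
move=> mf f0 fI; rewrite ge0_integral_lebesgue_mx; last 2 first.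
- apply/measurable_EFinP; apply: measurable_prod => i _.
  exact: measurableT_comp (mf i) (@measurable_coord R 1 d ord0 i).
- by move=> x; rewrite lee_fin prodr_ge0.
transitivity (\prod_(i < 1 * d) I i)%:E; last first.
  congr EFin; rewrite -(big_mkord xpredT I) -(big_mkord xpredT I).
  by rewrite mul1n.
rewrite -(integral_lebesgue_tuple_prod _ mf f0 fI).
apply: eq_integral => t _; congr EFin.
transitivity (\prod_(0 <= i < d) f i (nth 0%R t i))%R.
  rewrite big_mkord; apply: eq_bigr => j _.
  by rewrite mxE (tnth_nth 0%R) val_mxvec_index.
rewrite -{1}(mul1n d) big_mkord; apply: eq_bigr => j _.
by rewrite (tnth_nth 0%R).
Qed.

End integral_lebesgue_mx.

(** * The heat kernel *)

Section heat_kernel.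
Context (R : realType).

(** Inversion is discontinuous at 0, hence the detour x^-1 = x (x^2)^-1, in which only a
    nonnegative number is inverted and inversion is a real power. *)
Lemma measurable_invr d (X : measurableType d) (f : X -> R) :
  measurable_fun setT f -> measurable_fun setT (fun x => (f x)^-1).
Proof.
move=> mf; rewrite (_ : (fun x => _) = fun x => f x * (f x ^+ 2) `^ (-1)).
  apply: measurable_funM => //.
  apply: (measurableT_comp (measurable_powR (-1))).
  exact: measurable_funX.
apply/funext => x; rewrite powR_inv1 ?sqr_ge0 // expr2 invfM.
by have [->|fx0] := eqVneq (f x) 0; rewrite ?invr0 ?mul0r // mulrA divff ?mul1r.
Qed.

Lemma heat_kernel_ge0 d t (z : 'rV[R]_d) : 0 <= heat_kernel t z.
Proof. by rewrite mulr_ge0 ?powR_ge0 ?expR_ge0. Qed.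

Lemma heat_kernel_le d t (z : 'rV[R]_d) : 0 < t ->
  heat_kernel t z <= (4 * pi * t) `^ (- (d%:R / 2)).
Proof.
move=> t0; rewrite /heat_kernel -[leRHS]mulr1 ler_wpM2l ?powR_ge0 //.
rewrite expR_le1 mulNr oppr_le0 divr_ge0 ?mulr_ge0 ?(ltW t0) //.
by apply: sumr_ge0 => i _; exact: sqr_ge0.
Qed.

Lemma heat_kernelN d t (z : 'rV[R]_d) : heat_kernel t (- z) = heat_kernel t z.
Proof.
by rewrite /heat_kernel; under eq_bigr do rewrite mxE sqrrN.
Qed.

Lemma heat_kernelC d t (x y : 'rV[R]_d) :
  heat_kernel t (x - y) = heat_kernel t (y - x).
Proof. by rewrite -heat_kernelN opprB. Qed.

Lemma measurable_heat_kernel d dX (X : measurableType dX) (a : X -> R)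
    (z : X -> 'rV[R]_d) :
  measurable_fun setT a -> (forall i, measurable_fun setT (fun x => z x 0 i)) ->
  measurable_fun setT (fun x => heat_kernel (a x) (z x)).
Proof.
move=> ma mz; apply: measurable_funM.
  apply: (measurableT_comp (measurable_powR (- (d%:R / 2)))).
  exact: measurable_funM.
apply: measurableT_comp => //; apply: measurable_funM.
  apply: measurable_funN; apply: measurable_sum => i.
  exact: measurable_funX.
by apply: measurable_invr; apply: measurable_funM.
Qed.

Lemma measurable_heat_kernelB d a (x : 'rV[R]_d) :
  measurable_fun setT (fun y : borel 'rV[R]_d => heat_kernel a (x - y)).
Proof.
apply: measurable_heat_kernel => // i.
rewrite (_ : (fun y => _) = fun y : borel 'rV[R]_d => x 0 i - y 0 i).
  by apply: measurable_funB => //; exact: measurable_coord.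
by apply/funext => y; rewrite !mxE.
Qed.

(** In each coordinate the kernel at time t is the normal density of variance 2 t, which
    gives access to the Gaussian integral. *)
Lemma heat_kernel_prod d t (x y : 'rV[R]_d) : 0 < t ->
  heat_kernel t (x - y) =
  \prod_(j < d) normal_pdf (x 0 j) (Num.sqrt (2 * t)) (y 0 j).
Proof.
move=> t0; have s0 : Num.sqrt (2 * t) != 0.
  by rewrite sqrtr_eq0 -ltNge mulr_gt0.
under eq_bigr do rewrite normal_pdfE //.
rewrite big_split /= prodr_const card_ord; congr (_ * _).
  rewrite /normal_peak sqr_sqrtr ?mulr_ge0 ?(ltW t0) //.
  rewrite exprVn powRN; congr _^-1.
  have -> : (2 * t * pi) *+ 2 = 4 * pi * t.
    by rewrite -mulr_natr; lra.
  have p0 : 0 <= 4 * pi * t by rewrite !mulr_ge0 ?pi_ge0 ?(ltW t0).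
  by rewrite -powR12_sqrt // -powR_mulrn ?powR_ge0 // -powRrM [2^-1 * _]mulrC.
rewrite /normal_fun -expR_sum -mulr_suml -sumrN; congr expR; congr (_ * _).
  by apply: eq_bigr => i _; rewrite !mxE -sqrrN opprB.
by rewrite sqr_sqrtr ?mulr_ge0 ?(ltW t0) // -mulr_natr; lra.
Qed.

Lemma integral_heat_kernel d t (x : 'rV[R]_d) : 0 < t ->
  (\int[lebesgue_mx R 1 d]_y (heat_kernel t (x - y))%:E = 1)%E.
Proof.
move=> t0; pose m (i : nat) := nth 0 [seq x 0 j | j <- enum 'I_d] i.
have mE (j : 'I_d) : m j = x 0 j.
  by rewrite /m (nth_map j) ?size_enum_ord ?nth_ord_enum.
have := @integral_lebesgue_rV_prod R d (fun i => normal_pdf (m i) (Num.sqrt (2 * t)))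
  (fun=> 1).
rewrite big1 // => <-.
- apply: eq_integral => y _; congr EFin; rewrite heat_kernel_prod //.
  by apply: eq_bigr => j _; rewrite mE.
- by move=> i; exact: measurable_normal_pdf.
- by move=> i y; exact: normal_pdf_ge0.
- by move=> i; exact: integral_normal_pdf.
Qed.

(** Completing the square in y: this identity is the content of the Chapman-Kolmogorov
    equation for Gaussian kernels. *)
Lemma gauss_exponentD (s t x y z : R) : 0 < s -> 0 < t ->
  (x - y) ^+ 2 / (4 * s) + (y - z) ^+ 2 / (4 * t) =
  (x - z) ^+ 2 / (4 * (s + t)) +
  (t / (s + t) * x + s / (s + t) * z - y) ^+ 2 / (4 * (s * t / (s + t))).
Proof.
move=> s0 t0; have st0 : 0 < s + t by rewrite addr_gt0.
have := mulVf (lt0r_neq0 st0).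
rewrite !invfM invrK; move: (s + t)^-1 => u uc.
pose p := x - y; pose q := y - z.
have -> : t * u * x + s * u * z - y = u * (t * p - s * q).
  by have := congr1 (fun w => y * w) uc; rewrite /p /q; lra.
have sa : s^-1 * s = 1 by rewrite mulVf ?gt_eqF.
have tb : t^-1 * t = 1 by rewrite mulVf ?gt_eqF.
move: s^-1 t^-1 sa tb => a b sa tb.
have -> : x - z = p + q by rewrite /p /q; lra.
rewrite -/p -/q.
suff : p ^+ 2 * a + q ^+ 2 * b =
    u * (p + q) ^+ 2 + (u * (s + t)) * u * (t * p - s * q) ^+ 2 * a * b by lra.
rewrite uc mul1r.
have -> : u * (p + q) ^+ 2 + u * (t * p - s * q) ^+ 2 * a * b =
    u * (p ^+ 2 + q ^+ 2 + 2 * p * q + t * p ^+ 2 * a * (b * t)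
      + s * q ^+ 2 * b * (a * s) - 2 * p * q * (a * s) * (b * t)) by lra.
rewrite sa tb !mulr1.
transitivity (u * (p ^+ 2 * (a * s) + q ^+ 2 * (b * t) + t * p ^+ 2 * a + s * q ^+ 2 * b)).
  have := congr1 (fun w => (p ^+ 2 * a + q ^+ 2 * b) * w) uc; lra.
by rewrite sa tb; lra.
Qed.

(** As a function of y the product of two kernels is again a kernel, up to a factor that
    survives the integration over y. *)
Lemma heat_kernelM d (s t : R) (x y z : 'rV[R]_d) : 0 < s -> 0 < t ->
  heat_kernel s (x - y) * heat_kernel t (y - z) =
  heat_kernel (s + t) (x - z) *
  heat_kernel (s * t / (s + t)) (((t / (s + t)) *: x + (s / (s + t)) *: z) - y).
Proof.
move=> s0 t0; have st0 : 0 < s + t by rewrite addr_gt0.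
have p4 : 0 < 4 * pi :> R by rewrite mulr_gt0 ?pi_gt0.
rewrite /heat_kernel mulrACA [RHS]mulrACA -!expRD; congr (_ * expR _).
  have p0 (r : R) : 0 < r -> 0 <= 4 * pi * r.
    by move=> r0; apply: ltW; exact: mulr_gt0.
  rewrite -!powRM ?p0 // ?divr_gt0 ?mulr_gt0 //; congr (_ `^ _).
  have u1 : (s + t) * (s + t)^-1 = 1 by rewrite divff ?gt_eqF.
  by have := congr1 (fun w => w * (4 * pi * s * (4 * pi * t))) u1; lra.
rewrite !mulNr -!opprD; congr (- _).
rewrite !mulr_suml -!big_split /=; apply: eq_bigr => i _; rewrite !mxE.
exact: gauss_exponentD.
Qed.

End heat_kernel.

(** * The heat semigroup on bounded measurable functions *)

Section heat_operator.
Context (R : realType) (d : nat).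
Local Notation E := (borel 'rV[R]_d).
Local Notation leb := (lebesgue_mx R 1 d).
Implicit Types (f g : 'rV[R]_d -> R) (L s t : R) (x : 'rV[R]_d).

(** With a sign and an upper bound all heat integrals are finite, so that one can pass between
    real and extended integrals and use Tonelli's theorem freely. *)
Definition meas_bounded L f : Prop :=
  measurable_fun setT (f : E -> R) /\ forall x, 0 <= f x <= L.

Lemma meas_bounded_ge0 L f x : meas_bounded L f -> 0 <= f x.
Proof. by move=> [_ /(_ x) /andP[]]. Qed.

Lemma meas_bounded_le L f x : meas_bounded L f -> f x <= L.
Proof. by move=> [_ /(_ x) /andP[]]. Qed.

Lemma meas_bounded_bound_ge0 L f : meas_bounded L f -> 0 <= L.
Proof. by move=> fL; rewrite (le_trans (meas_bounded_ge0 0 fL)) ?(meas_bounded_le 0 fL). Qed.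

Lemma measurable_heat_integrand a x f : measurable_fun setT (f : E -> R) ->
  measurable_fun setT (fun y : E => (heat_kernel a (x - y) * f y)%:E).
Proof.
move=> mf; apply/measurable_EFinP/measurable_funM => //.
exact: measurable_heat_kernelB.
Qed.

Lemma heat_integrand_ge0 a x f y : (forall y, 0 <= f y) ->
  (0 <= (heat_kernel a (x - y) * f y)%:E)%E.
Proof. by move=> f0; rewrite lee_fin mulr_ge0 ?heat_kernel_ge0. Qed.

Lemma heat_integral_le L a x f : 0 < a -> meas_bounded L f ->
  (\int[leb]_y (heat_kernel a (x - y) * f y)%:E <= L%:E)%E.
Proof.
move=> a0 fL; rewrite -[leRHS]mule1 -(integral_heat_kernel x a0) -ge0_integralZl //.
- apply: ge0_le_integral => //.
  + by move=> y _; apply: heat_integrand_ge0 => ?; exact: meas_bounded_ge0 fL.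
  + by apply: measurable_heat_integrand; case: fL.
  + apply: measurable_funeM; apply/measurable_EFinP.
    exact: measurable_heat_kernelB.
  + move=> y _; rewrite -EFinM lee_fin mulrC ler_wpM2r ?heat_kernel_ge0 //.
    exact: meas_bounded_le fL.
- by apply/measurable_EFinP; exact: measurable_heat_kernelB.
- by move=> y _; rewrite lee_fin heat_kernel_ge0.
- by rewrite lee_fin (meas_bounded_bound_ge0 fL).
Qed.

Lemma heat_EFin L a x f : 0 < a -> meas_bounded L f ->
  (heat a f x)%:E = (\int[leb]_y (heat_kernel a (x - y) * f y)%:E)%E.
Proof.
move=> a0 fL; rewrite /heat gt_eqF // fineK // ge0_fin_numE.
  exact: le_lt_trans (heat_integral_le x a0 fL) (ltry _).
by apply: integral_ge0 => y _; apply: heat_integrand_ge0 => ?; exact: meas_bounded_ge0 fL.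
Qed.

Lemma heat0 f : heat 0 f = f.
Proof. by apply/funext => x; rewrite /heat eqxx. Qed.

Lemma heat_ge0 a x f : (forall y, 0 <= f y) -> 0 <= heat a f x.
Proof.
move=> f0; rewrite /heat; case: ifP => // _; apply: Rintegral_ge0 => y _.
by rewrite mulr_ge0 ?heat_kernel_ge0.
Qed.

Lemma heat_le_bound L a x f : 0 <= a -> meas_bounded L f -> heat a f x <= L.
Proof.
rewrite le_eqVlt => /predU1P[<-|a0] fL; first by rewrite heat0 (meas_bounded_le _ fL).
by rewrite -lee_fin (heat_EFin _ a0 fL) heat_integral_le.
Qed.

Lemma le_heat L a x f g : 0 <= a -> meas_bounded L f -> meas_bounded L g ->
  (forall y, f y <= g y) -> heat a f x <= heat a g x.
Proof.
rewrite le_eqVlt => /predU1P[<-|a0] fL gL fg; first by rewrite !heat0.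
rewrite -lee_fin (heat_EFin _ a0 fL) (heat_EFin _ a0 gL).
apply: ge0_le_integral => //.
- by move=> y _; apply: heat_integrand_ge0 => ?; exact: meas_bounded_ge0 fL.
- by apply: measurable_heat_integrand; case: fL.
- by apply: measurable_heat_integrand; case: gL.
- by move=> y _; rewrite lee_fin ler_wpM2l ?heat_kernel_ge0.
Qed.

Lemma heatZ L c a x f : 0 <= a -> 0 <= c -> meas_bounded L f ->
  heat a (fun y => c * f y) x = c * heat a f x.
Proof.
rewrite le_eqVlt => /predU1P[<-|a0] c0 fL; first by rewrite !heat0.
have cfL : meas_bounded (c * L) (fun y => c * f y).
  split=> [|y]; first by apply: measurable_funM => //; case: fL.
  by rewrite mulr_ge0 ?(meas_bounded_ge0 _ fL) // ler_wpM2l ?(meas_bounded_le _ fL).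
apply: EFin_inj; rewrite EFinM (heat_EFin _ a0 fL) (heat_EFin _ a0 cfL).
rewrite -ge0_integralZl //.
- by apply: eq_integral => y _; rewrite -EFinM mulrCA.
- by apply: measurable_heat_integrand; case: fL.
- by move=> y _; apply: heat_integrand_ge0 => ?; exact: meas_bounded_ge0 fL.
Qed.

Lemma heatD L1 L2 a x f g : 0 <= a -> meas_bounded L1 f -> meas_bounded L2 g ->
  heat a (fun y => f y + g y) x = heat a f x + heat a g x.
Proof.
rewrite le_eqVlt => /predU1P[<-|a0] fL gL; first by rewrite !heat0.
have fgL : meas_bounded (L1 + L2) (fun y => f y + g y).
  split=> [|y]; first by apply: measurable_funD; [case: fL|case: gL].
  rewrite addr_ge0 ?(meas_bounded_ge0 _ fL) ?(meas_bounded_ge0 _ gL) //.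
  by rewrite lerD ?(meas_bounded_le _ fL) ?(meas_bounded_le _ gL).
apply: EFin_inj; rewrite EFinD (heat_EFin _ a0 fL) (heat_EFin _ a0 gL).
rewrite (heat_EFin _ a0 fgL) -ge0_integralD //.
- by apply: eq_integral => y _; rewrite -EFinD mulrDr.
- by move=> y _; apply: heat_integrand_ge0 => ?; exact: meas_bounded_ge0 fL.
- by apply: measurable_heat_integrand; case: fL.
- by move=> y _; apply: heat_integrand_ge0 => ?; exact: meas_bounded_ge0 gL.
- by apply: measurable_heat_integrand; case: gL.
Qed.

Lemma heatN a x f : (forall y, 0 <= f y) ->
  heat a (fun y => - f y) x = - heat a f x.
Proof.
move=> f0; rewrite /heat; case: ifP => // _; rewrite /Rintegral -fineN.
rewrite -integral_ge0N; last by move=> y _; exact: heat_integrand_ge0.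
by congr fine; apply: eq_integral => y _; rewrite mulrN EFinN.
Qed.

(** Heat integrals are integrated again, in time or in space; this needs measurability jointly
    in the time, the point and the function. *)
Lemma measurable_heat_param dX (X : measurableType dX) (a : X -> R)
    (z : X -> 'rV[R]_d) (W : X -> 'rV[R]_d -> R) :
  measurable_fun setT a -> (forall i, measurable_fun setT (fun w => z w 0 i)) ->
  measurable_fun setT (fun p : X * E => W p.1 p.2) ->
  (forall w y, 0 <= W w y) ->
  measurable_fun setT (fun w =>
    \int[leb]_y (heat_kernel (a w) (z w - y) * W w y)%:E)%E.
Proof.
move=> ma mz mW W0.
pose F (p : X * E) := (heat_kernel (a p.1) (z p.1 - p.2) * W p.1 p.2)%:E.
have := @measurable_fun_fubini_tonelli_F _ _ X E R leb F; apply.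
- apply/measurable_EFinP/measurable_funM => //.
  apply: measurable_heat_kernel; first exact: measurableT_comp ma measurable_fst.
  move=> i; rewrite (_ : (fun p => _) = fun p : X * E => z p.1 0 i - p.2 0 i).
    apply: measurable_funB; first exact: measurableT_comp (mz i) measurable_fst.
    exact: measurableT_comp (@measurable_coord R 1 d 0 i) measurable_snd.
  by apply/funext => p; rewrite !mxE.
- by move=> p; apply: heat_integrand_ge0.
Qed.

Lemma measurable_heat L a f : 0 <= a -> meas_bounded L f ->
  measurable_fun setT (heat a f : E -> R).
Proof.
rewrite le_eqVlt => /predU1P[<-|a0] fL; first by rewrite heat0; case: fL.
apply/measurable_EFinP.
rewrite (_ : _ \o _ = fun x => \int[leb]_y (heat_kernel a (x - y) * f y)%:E)%E.
  apply: (@measurable_heat_param _ E (fun=> a) id (fun _ y => f y)) => //.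
  - by move=> i; exact: measurable_coord.
  - by apply: measurableT_comp (measurable_snd); case: fL.
  - by move=> _ y; exact: meas_bounded_ge0 fL.
by apply/funext => x /=; rewrite (heat_EFin _ a0 fL).
Qed.

Lemma meas_bounded_heat L a f : 0 <= a -> meas_bounded L f -> meas_bounded L (heat a f).
Proof.
move=> a0 fL; split=> [|x]; first exact: measurable_heat fL.
by rewrite heat_ge0 ?(heat_le_bound _ a0 fL) // => y; exact: meas_bounded_ge0 fL.
Qed.

Lemma heat_kernel_comp (s t : R) (x z : 'rV[R]_d) : 0 < s -> 0 < t ->
  (\int[leb]_y (heat_kernel s (x - y) * heat_kernel t (y - z))%:E =
   (heat_kernel (s + t) (x - z))%:E)%E.
Proof.
move=> s0 t0; under eq_integral do rewrite heat_kernelM // EFinM.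
rewrite ge0_integralZl //.
- by rewrite integral_heat_kernel ?mule1 // divr_gt0 ?mulr_gt0 ?addr_gt0.
- by apply/measurable_EFinP; exact: measurable_heat_kernelB.
- by move=> y _; rewrite lee_fin heat_kernel_ge0.
- by rewrite lee_fin heat_kernel_ge0.
Qed.

(** Exchange the two integrals and apply the Chapman-Kolmogorov equation to the kernels. *)
Lemma heat_heat L s t x f : 0 <= s -> 0 <= t -> meas_bounded L f ->
  heat s (heat t f) x = heat (s + t) f x.
Proof.
rewrite le_eqVlt => /predU1P[<-|s0]; first by move=> ? ?; rewrite heat0 add0r.
rewrite le_eqVlt => /predU1P[<-|t0] fL; first by rewrite !heat0 addr0.
have htL := meas_bounded_heat (ltW t0) fL.
have f0 y := meas_bounded_ge0 y fL.
apply: EFin_inj; rewrite (heat_EFin _ s0 htL) (heat_EFin _ (addr_gt0 s0 t0) fL).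
pose F (p : E * E) := (heat_kernel s (x - p.1) * (heat_kernel t (p.1 - p.2) * f p.2))%:E.
have F0 p : (0 <= F p)%E.
  rewrite lee_fin; exact: mulr_ge0 (heat_kernel_ge0 _ _)
    (mulr_ge0 (heat_kernel_ge0 _ _) (f0 _)).
have mF : measurable_fun setT F.
  apply/measurable_EFinP/measurable_funM; [|apply: measurable_funM].
  - exact: measurableT_comp (measurable_heat_kernelB s x) measurable_fst.
  - apply: measurable_heat_kernel => // i.
    rewrite (_ : (fun p => _) = fun p : E * E => p.1 0 i - p.2 0 i).
      by apply: measurable_funB;
        apply: (measurableT_comp (@measurable_coord R 1 d 0 i)).
    by apply/funext => p; rewrite !mxE.
  - by apply: measurableT_comp (measurable_snd); case: fL.
transitivity (\int[leb]_y \int[leb]_z F (y, z))%E.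
  apply: eq_integral => y _; rewrite EFinM (heat_EFin _ t0 fL) -ge0_integralZl //.
  - by apply: measurable_heat_integrand; case: fL.
  - by move=> z _; exact: heat_integrand_ge0.
  - by rewrite lee_fin heat_kernel_ge0.
rewrite (fubini_tonelli F mF F0); apply: eq_integral => z _.
rewrite EFinM -heat_kernel_comp // -ge0_integralZr //.
- by apply: eq_integral => y _; rewrite -EFinM -mulrA.
- apply/measurable_EFinP/measurable_funM; first exact: measurable_heat_kernelB.
  rewrite (_ : (fun y => _) = fun y => heat_kernel t (z - y)).
    exact: measurable_heat_kernelB.
  by apply/funext => y; rewrite heat_kernelC.
- by move=> y _; rewrite lee_fin mulr_ge0 ?heat_kernel_ge0.
- by rewrite lee_fin.
Qed.

(** Heat flow preserves mass because the kernel is symmetric with total mass 1. *)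
Lemma integral_heat L t f : 0 <= t -> meas_bounded L f ->
  (\int[leb]_x (heat t f x)%:E = \int[leb]_x (f x)%:E)%E.
Proof.
rewrite le_eqVlt => /predU1P[<-|t0] fL; first by rewrite heat0.
have f0 y := meas_bounded_ge0 y fL.
pose F (p : E * E) := (heat_kernel t (p.1 - p.2) * f p.2)%:E.
have F0 p : (0 <= F p)%E.
  by rewrite lee_fin; exact: mulr_ge0 (heat_kernel_ge0 _ _) (f0 _).
have mF : measurable_fun setT F.
  apply/measurable_EFinP/measurable_funM.
  - apply: measurable_heat_kernel => // i.
    rewrite (_ : (fun p => _) = fun p : E * E => p.1 0 i - p.2 0 i).
      by apply: measurable_funB;
        apply: (measurableT_comp (@measurable_coord R 1 d 0 i)).
    by apply/funext => p; rewrite !mxE.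
  - by apply: measurableT_comp (measurable_snd); case: fL.
transitivity (\int[leb]_y \int[leb]_z F (y, z))%E.
  by apply: eq_integral => y _; rewrite (heat_EFin _ t0 fL).
rewrite (fubini_tonelli F mF F0); apply: eq_integral => z _.
rewrite /F /=; under eq_integral do rewrite EFinM.
rewrite ge0_integralZr //.
- under eq_integral do rewrite heat_kernelC.
  by rewrite integral_heat_kernel // mul1e.
- rewrite (_ : (fun y => _) = fun y => (heat_kernel t (z - y))%:E).
    by apply/measurable_EFinP; exact: measurable_heat_kernelB.
  by apply/funext => y; rewrite heat_kernelC.
- by move=> y _; rewrite lee_fin heat_kernel_ge0.
- by rewrite lee_fin.
Qed.

(** The kernel is largest at the origin. *)
Lemma heat_le_mass L M t x f : 0 < t -> meas_bounded L f ->
  (\int[leb]_x (f x)%:E = M%:E)%E ->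
  heat t f x <= (4 * pi * t) `^ (- (d%:R / 2)) * M.
Proof.
move=> t0 fL fM; have f0 y := meas_bounded_ge0 y fL.
rewrite -lee_fin (heat_EFin _ t0 fL) EFinM -fM -ge0_integralZl //.
- apply: ge0_le_integral => //.
  + by move=> y _; exact: heat_integrand_ge0.
  + by apply: measurable_heat_integrand; case: fL.
  + by apply: measurable_funeM; apply/measurable_EFinP; case: fL.
  + by move=> y _; rewrite -EFinM lee_fin ler_wpM2r // heat_kernel_le.
- by apply/measurable_EFinP; case: fL.
- by move=> y _; rewrite lee_fin.
- by rewrite lee_fin powR_ge0.
Qed.

End heat_operator.

(** * A scalar balance equation and exponential weights *)

Section exponential_weights.
Context (R : realType).
Local Notation mu := (@lebesgue_measure R).

Lemma integral_expR (c a b : R) : a <= b ->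
  (\int[mu]_(s in `[a, b[) (c * expR (c * s))%:E = (expR (c * b) - expR (c * a))%:E)%E.
Proof.
have cE : continuous (fun s : R => expR (c * s)).
  move=> s; apply: (@continuous_comp _ _ _ ( *%R c) expR).
    exact: mulrl_continuous.
  exact: continuous_expR.
have mE : measurable_fun setT (fun s : R => (c * expR (c * s))%:E).
  apply/measurable_EFinP/measurable_funM => //.
  exact: continuous_measurable_fun.
rewrite le_eqVlt => /predU1P[<-|ab].
  by rewrite set_itv_ge ?integral_set0 ?subrr // bnd_simp ltxx.
rewrite integral_itv_bndo_bndc; last exact: measurable_funTS.
have dE (s : R) : is_derive s (1 : R) (fun s => expR (c * s)) (c * expR (c * s)).
  have := @is_derive1_comp R expR ( *%R c) s _ _ (is_derive_expR _)
    (is_deriveZ c (is_derive_id s 1)).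
  by rewrite /= -[_ *: _]/(_ * _) mulr1 mulrC.
rewrite (@continuous_FTC2 _ _ (fun s => expR (c * s))) ?EFinB //.
- apply: continuous_subspaceT => s; apply: cvgM; [exact: cvg_cst|exact: cE].
- split.
  + by move=> s _; case: (dE s).
  + by apply: cvg_at_right_filter; exact: cE.
  + by apply: cvg_at_left_filter; exact: cE.
- by move=> s _; rewrite derive1E; case: (dE s).
Qed.

(** Between the times [T] and [t] an amount [psi] is lost at the rate [loss]. The rate is only
    measurable, so that [psi] need not be differentiable; the product rule for an exponential
    times [psi] is obtained in integrated form from Tonelli's theorem. *)
Section exp_weight.
Context (T t : R) (psi loss : R -> R).
Context (Tt : T <= t).
Context (mpsi : measurable_fun `[T, t[ psi).
Context (mloss : measurable_fun `[T, t[ loss).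
Context (psi0 : forall s, T <= s <= t -> 0 <= psi s).
Context (loss0 : forall s, T <= s < t -> 0 <= loss s).
Context (balance : forall r, T <= r <= t ->
  ((psi r)%:E + \int[mu]_(s in `[T, r[) (loss s)%:E = (psi T)%:E)%E).

Lemma integral_loss_le r : T <= r <= t ->
  (\int[mu]_(s in `[T, r[) (loss s)%:E <= (psi T)%:E)%E.
Proof.
by move=> rP; rewrite -(balance rP) leeDr // lee_fin psi0.
Qed.

Lemma balance_tail r : T <= r <= t ->
  ((psi t)%:E + \int[mu]_(s in `[r, t[) (loss s)%:E = (psi r)%:E)%E.
Proof.
move=> rP; have /andP[Tr rt] := rP.
have h1 := balance rP.
have tP : T <= t <= t by rewrite Tt lexx.
have := balance tP.
have U : `[T, t[%classic = `[T, r[ `|` `[r, t[ by exact: itv_bndbnd_setU.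
rewrite U ge0_integral_setU //; last 3 first.
- by rewrite -U; exact/measurable_EFinP.
- by rewrite -U => s; rewrite /= in_itv /= => sP; rewrite lee_fin loss0.
- apply/disj_setPS => s [] /=; rewrite !in_itv /= => /andP[_ sr] /andP[rs _].
  by rewrite leNgt sr in rs.
have fI : (\int[mu]_(s in `[T, r[) (loss s)%:E \is a fin_num)%E.
  rewrite ge0_fin_numE; last first.
    apply: integral_ge0 => s; rewrite /= in_itv /= => /andP[Ts sr].
    by rewrite lee_fin loss0 // Ts (lt_le_trans sr rt).
  exact: le_lt_trans (integral_loss_le rP) (ltry _).
rewrite -h1 addeCA [in RHS]addeC => h.
by move/(congr1 (fun z => z - \int[mu]_(s in `[T, r[) (loss s)%:E)%E): h;
  rewrite !(addeC (\int[mu]_(s in `[T, r[) (loss s)%:E)%E) !addeK.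
Qed.

(** The bracket on the left is the integral of rho exp (rho r) over r between T and s;
    exchange the integrals over r and s. *)
Lemma exp_weight_fubini (rho : R) : 0 <= rho ->
  (\int[mu]_(s in `[T, t[)
     ((expR (rho * s) - expR (rho * T)) * loss s)%:E =
   \int[mu]_(r in `[T, t[)
     ((rho * expR (rho * r))%:E * \int[mu]_(s in `[r, t[) (loss s)%:E))%E.
Proof.
move=> rho0; pose K := loss \_ `[T, t[.
have mK : measurable_fun setT K 
  by apply: (measurable_restrictT loss _).1 => //; exact: mloss.
have KE s : T <= s < t -> K s = loss s.
  by move=> sP; rewrite /K patchE mem_set //= in_itv.
have K0E s : ~~ (T <= s < t) -> K s = 0.
  by move=> sP; rewrite /K patchE memNset //= in_itv /=; exact/negP.
have K0 s : 0 <= K s.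
  by case: (boolP (T <= s < t)) => sP; [rewrite KE // loss0|rewrite K0E].
pose w (r : R) : R := rho * expR (rho * r).
have w0 r : 0 <= w r by rewrite mulr_ge0 ?expR_ge0.
have mw : measurable_fun setT w.
  apply: measurable_funM => //.
  by apply: measurableT_comp => //; exact: mulrl_measurable.
pose F (p : measurableTypeR R * measurableTypeR R) : \bar R :=
  (if (T <= p.1) && (p.1 <= p.2) then w p.1 * K p.2 else 0)%:E.
have mF : measurable_fun setT F.
  apply/measurable_EFinP; apply: measurable_fun_ifT => //.
    apply: measurable_and; apply: measurable_fun_ler => //.
  apply: measurable_funM.
    exact: measurableT_comp mw measurable_fst.
  exact: measurableT_comp mK measurable_snd.
have F0 p : (0 <= F p)%E.
  by rewrite /F lee_fin; case: ifP => // _; rewrite mulr_ge0.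
have := fubini_tonelli (m1 := mu) (m2 := mu) F mF F0.
have -> : (\int[mu]_r \int[mu]_s F (r, s) = \int[mu]_(r in `[T, t[)
     ((rho * expR (rho * r))%:E * \int[mu]_(s in `[r, t[) (loss s)%:E))%E.
  rewrite [RHS]integral_mkcond; apply: eq_integral => r _.
  rewrite patchE; case: ifPn => [|].
    rewrite inE /= in_itv /= => /andP[Tr rt].
    rewrite -ge0_integralZl //; last 3 first.
    - apply/measurable_EFinP; apply: measurable_funS mloss => //.
      by apply: subset_itvr; rewrite bnd_simp.
    - move=> s; rewrite /= in_itv /= => /andP[rs st].
      by rewrite lee_fin loss0 // st (le_trans Tr).
    - by rewrite lee_fin; exact: w0.
    rewrite [RHS]integral_mkcond; apply: eq_integral => s _.
    rewrite patchE /F /= Tr /=; case: ifPn => [rs|].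
      case: ifPn => [|].
        rewrite inE /= in_itv /= rs /= => st.
        by rewrite KE ?st ?(le_trans Tr) // EFinM.
      rewrite notin_setE /= in_itv /= rs /= => /negP; rewrite -leNgt => ts.
      by rewrite K0E ?mulr0 // negb_and -!leNgt ts orbT.
    rewrite -ltNge => sr; rewrite ifF //.
    by apply/negbTE; rewrite notin_setE /= in_itv /= leNgt sr.
  rewrite notin_setE /= in_itv /= => /negP; rewrite negb_and -leNgt -ltNge => h.
  rewrite integral0_eq // => s _; rewrite /F /=; case: ifP => // /andP[Tr rs].
  move: h; rewrite ltNge Tr /= => tr.
  by rewrite K0E ?mulr0 // negb_and -leNgt (le_trans tr rs) orbT.
move=> ->; rewrite [LHS]integral_mkcond; apply: eq_integral => s _.
rewrite patchE; case: ifPn => [|].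
  rewrite inE /= in_itv /= => /andP[Ts st].
  rewrite EFinM -integral_expR // -ge0_integralZr //; last 3 first.
  - by apply/measurable_EFinP; exact: measurable_funTS.
  - by move=> r _; rewrite lee_fin; exact: w0.
  - by rewrite lee_fin loss0 ?Ts.
  rewrite integral_itv_bndo_bndc; last first.
    apply/measurable_EFinP/measurable_funM => //.
    by apply: measurable_funTS; exact: mw.
  rewrite [LHS]integral_mkcond; apply: eq_integral => r _.
  rewrite patchE /F /= KE ?Ts // mem_setE /= in_itv /=.
  by case: ifP.
rewrite notin_setE /= in_itv /= => /negP h.
by rewrite integral0_eq // => r _; rewrite /F /=; case: ifP => // _; rewrite K0E // mulr0.
Qed.

(** The integrated form of (exp (rho s) psi)' = exp (rho s) (rho psi - loss), written without
    subtraction. *)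
Lemma exp_weight_eq (rho : R) : 0 <= rho ->
  ((expR (rho * t) * psi t)%:E + \int[mu]_(s in `[T, t[) (expR (rho * s) * loss s)%:E =
   (expR (rho * T) * psi T)%:E +
   \int[mu]_(s in `[T, t[) (rho * expR (rho * s) * psi s)%:E)%E.
Proof.
move=> rho0.
have tP : T <= t <= t by rewrite Tt lexx.
have mw : measurable_fun setT (fun r => rho * expR (rho * r)).
  apply: measurable_funM => //.
  by apply: measurableT_comp => //; exact: mulrl_measurable.
have w0 r : 0 <= rho * expR (rho * r) by rewrite mulr_ge0 ?expR_ge0.
have ET s : T <= s -> expR (rho * T) <= expR (rho * s).
  by move=> Ts; rewrite ler_expR ler_wpM2l.
have Is r : T <= r < t -> (0 <= \int[mu]_(s in `[r, t[) (loss s)%:E)%E.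
  move=> /andP[Tr rt]; apply: integral_ge0 => s; rewrite /= in_itv /= => /andP[rs st].
  by rewrite lee_fin loss0 // st (le_trans Tr).
transitivity ((expR (rho * T) * psi T)%:E +
    (\int[mu]_(r in `[T, t[) ((rho * expR (rho * r)) * psi t)%:E +
   \int[mu]_(r in `[T, t[)
     ((rho * expR (rho * r))%:E * \int[mu]_(s in `[r, t[) (loss s)%:E)))%E; last first.
  congr (_ + _)%E; rewrite -ge0_integralD //; last 4 first.
  - by move=> r _; rewrite lee_fin mulr_ge0 ?psi0.
  - apply/measurable_EFinP/measurable_funM => //; exact: measurable_funTS.
  - move=> r; rewrite /= in_itv /= => rP; apply: mule_ge0; last exact: Is.
    by rewrite lee_fin.
  - apply: (eq_measurable_fun (fun r => (rho * expR (rho * r) * (psi r - psi t))%:E)).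
      move=> r; rewrite inE /= in_itv /= => rP.
      rewrite EFinM EFinB; congr (_ * _)%E.
      rewrite -(balance_tail (r := r)); last by case/andP: rP => -> /ltW.
      by rewrite [in LHS]addeC addeA [(- _ + _)%E]addeC subee // add0e.
    apply/measurable_EFinP; apply: measurable_funM; first exact: measurable_funTS.
    exact: measurable_funB.
  apply: eq_integral => r; rewrite inE /= in_itv /= => rP.
  rewrite EFinM -ge0_muleDr ?lee_fin ?psi0 ?Is // ?Tt ?lexx //.
  by rewrite balance_tail ?EFinM //; case/andP: rP => -> /ltW.
rewrite -exp_weight_fubini //.
have -> : (\int[mu]_(r in `[T, t[) (rho * expR (rho * r) * psi t)%:E =
    ((expR (rho * t) - expR (rho * T)) * psi t)%:E)%E.
  rewrite EFinM -integral_expR // -ge0_integralZr //; last 3 first.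
  - by apply/measurable_EFinP; exact: measurable_funTS.
  - by move=> r _; rewrite lee_fin; exact: w0.
  - by rewrite lee_fin psi0.
have -> : (\int[mu]_(s in `[T, t[) (expR (rho * s) * loss s)%:E =
   \int[mu]_(s in `[T, t[) ((expR (rho * s) - expR (rho * T)) * loss s)%:E +
   (expR (rho * T))%:E * \int[mu]_(s in `[T, t[) (loss s)%:E)%E.
  rewrite -ge0_integralZl //; last exact/measurable_EFinP.
  rewrite -ge0_integralD //; last 4 first.
  - move=> s; rewrite /= in_itv /= => sP; rewrite lee_fin mulr_ge0 ?loss0 // subr_ge0 ET //.
    by case/andP: sP.
  - apply/measurable_EFinP; apply: measurable_funM => //; apply: measurable_funB => //.
    by apply: measurable_funTS; apply: measurableT_comp => //; exact: mulrl_measurable.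
  - by move=> s; rewrite /= in_itv /= => sP; rewrite -EFinM lee_fin mulr_ge0 ?expR_ge0 ?loss0.
  - by apply: measurable_funeM; exact/measurable_EFinP.
  by apply: eq_integral => s _; rewrite -EFinM -EFinD mulrBl subrK.
set J := (\int[mu]_(s in `[T, t[) ((expR (rho * s) - _) * loss s)%:E)%E.
have := balance tP.
have := integral_loss_le tP.
set I := (\int[mu]_(s in `[T, t[) (loss s)%:E)%E => Ile.
have /fineK <- : I \is a fin_num.
  rewrite ge0_fin_numE; first exact: le_lt_trans Ile (ltry _).
  by apply: integral_ge0 => s; rewrite /= in_itv /= => sP; rewrite lee_fin loss0.
rewrite -EFinD => -[psiT].
rewrite -EFinM addeCA [in RHS]addeA [RHS]addeC -!EFinD; congr (_ + _%:E)%E.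
by rewrite -psiT; lra.
Qed.

Lemma exp_weighted_loss_fin (rho : R) : 0 <= rho ->
  (\int[mu]_(s in `[T, t[) (expR (rho * s) * loss s)%:E \is a fin_num)%E.
Proof.
move=> rho0; have tP : T <= t <= t by rewrite Tt lexx.
rewrite ge0_fin_numE; last first.
  apply: integral_ge0 => s; rewrite /= in_itv /= => sP.
  by rewrite lee_fin mulr_ge0 ?expR_ge0 ?loss0.
apply: (@le_lt_trans _ _ ((expR (rho * t))%:E * (psi T)%:E)%E); last exact: ltry.
apply: le_trans (lee_wpmul2l _ (integral_loss_le tP)); last by rewrite lee_fin expR_ge0.
rewrite -ge0_integralZl //; last exact/measurable_EFinP.
apply: ge0_le_integral => //.
- move=> s; rewrite /= in_itv /= => sP.
  by rewrite lee_fin mulr_ge0 ?expR_ge0 ?loss0.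
- apply/measurable_EFinP; apply: measurable_funM => //.
  by apply: measurable_funTS; apply: measurableT_comp => //; exact: mulrl_measurable.
- by apply: measurable_funeM; exact/measurable_EFinP.
- move=> s; rewrite /= in_itv /= => sP; rewrite -EFinM lee_fin ler_wpM2r ?loss0 //.
  by rewrite ler_expR ler_wpM2l // ltW //; case/andP: sP.
Qed.

Lemma exp_weight_nondecreasing (rho : R) : 0 <= rho ->
  (forall s, T <= s < t -> loss s <= rho * psi s) ->
  expR (rho * T) * psi T <= expR (rho * t) * psi t.
Proof.
move=> rho0 losspsi; rewrite -lee_fin -(leeD2rE _ _ (exp_weighted_loss_fin rho0)).
rewrite (exp_weight_eq rho0); apply: leeD2l; apply: ge0_le_integral.
- exact: measurable_itv.
- move=> s; rewrite /= in_itv /= => sP.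
  by rewrite lee_fin mulr_ge0 ?expR_ge0 ?loss0.
- apply/measurable_EFinP; apply: measurable_funM => //.
  by apply: measurable_funTS; apply: measurableT_comp => //; exact: mulrl_measurable.
- apply/measurable_EFinP; apply: measurable_funM => //; apply: measurable_funM => //.
  by apply: measurable_funTS; apply: measurableT_comp => //; exact: mulrl_measurable.
- move=> s; rewrite /= in_itv /= => sP; rewrite lee_fin -[leRHS]mulrA [leRHS]mulrCA.
  by rewrite ler_wpM2l ?expR_ge0 ?losspsi.
Qed.

(** By [exp_weight_eq] the weighted amount grows by the integral of
    exp (rho s) (rho psi - loss), which is here at most the integral of B exp (- c s). *)
Lemma exp_weight_le (rho B c : R) : 0 <= rho -> 0 <= B -> 0 < c ->
  (forall s, T <= s < t -> rho * psi s <= loss s + B * expR (- (rho + c) * s)) ->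
  expR (rho * t) * psi t <= expR (rho * T) * psi T + B / c * expR (- c * T).
Proof.
move=> rho0 B0 c0 psilossB.
have mexp (k : R) : measurable_fun `[T, t[ (fun s : R => expR (k * s)).
  by apply: measurable_funTS; apply: measurableT_comp => //; exact: mulrl_measurable.
rewrite -lee_fin -(leeD2rE _ _ (exp_weighted_loss_fin rho0)) exp_weight_eq //.
rewrite EFinD -addeA; apply: leeD2l.
have D : (\int[mu]_(s in `[T, t[) (B * expR (- c * s))%:E <= (B / c * expR (- c * T))%:E)%E.
  have -> : (\int[mu]_(s in `[T, t[) (B * expR (- c * s))%:E =
      \int[mu]_(s in `[T, t[) ((B / c)%:E * (c * expR (- c * s))%:E))%E.
    by apply: eq_integral => s _; rewrite -EFinM mulrA divfK ?gt_eqF.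
  have e0 (s : R) : 0 <= c * expR (- c * s) by apply: mulr_ge0; [exact: ltW|exact: expR_ge0].
  rewrite ge0_integralZl //; last 3 first.
  - by apply/measurable_EFinP; apply: measurable_funM => //; exact: mexp.
  - by move=> s _; rewrite lee_fin.
  - by rewrite lee_fin divr_ge0 // ltW.
  have -> : (\int[mu]_(s in `[T, t[) (c * expR (- c * s))%:E =
      (expR (- c * T) - expR (- c * t))%:E)%E.
    apply: oppe_inj; rewrite -integral_ge0N; last by move=> s _; rewrite lee_fin.
    rewrite -EFinN opprB -integral_expR //.
    by apply: eq_integral => s _; rewrite -EFinN [in RHS]mulNr.
  by rewrite -EFinM lee_fin ler_wpM2l ?gerBl ?expR_ge0 // divr_ge0 // ltW.
rewrite addeC; apply: le_trans (leeD2l _ D).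
rewrite -ge0_integralD //; last 4 first.
- move=> s; rewrite /= in_itv /= => sP.
  by rewrite lee_fin mulr_ge0 ?expR_ge0 ?loss0.
- by apply/measurable_EFinP; apply: measurable_funM => //; exact: mexp.
- by move=> s _; rewrite lee_fin mulr_ge0 ?expR_ge0.
- by apply/measurable_EFinP; apply: measurable_funM => //; exact: mexp.
apply: ge0_le_integral => //.
- move=> s; rewrite /= in_itv /= => sP; rewrite lee_fin !mulr_ge0 ?expR_ge0 ?psi0 //.
  by case/andP: sP => -> /ltW.
- apply/measurable_EFinP; apply: measurable_funM => //.
  by apply: measurable_funM => //; exact: mexp.
- apply: emeasurable_funD; apply/measurable_EFinP; apply: measurable_funM => //.
    exact: mexp.
  exact: mexp.
move=> s; rewrite /= in_itv /= => sP; rewrite -EFinD lee_fin -[leLHS]mulrA [leLHS]mulrCA.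
apply: le_trans (ler_wpM2l (expR_ge0 _) (psilossB _ sP)) _.
rewrite mulrDr lerD2l mulrCA -expRD.
by rewrite (_ : rho * s + - (rho + c) * s = - c * s) //; lra.
Qed.

End exp_weight.
End exponential_weights.

(** * Duhamel's formula for damped heat flows *)

Section duhamel.
Context (R : realType) (d : nat).
Local Notation E := (borel 'rV[R]_d).
Local Notation RR := (measurableTypeR R).
Local Notation leb := (lebesgue_mx R 1 d).
Local Notation mu := (@lebesgue_measure R).

Lemma measurable_heat_time (W : R -> 'rV[R]_d -> R) (D : set R) (t : R) x :
  measurable_fun [set: RR * E] (fun p => W p.1 p.2) -> (forall s y, 0 <= W s y) ->
  measurable D -> D `<=` `]-oo, t[ ->
  measurable_fun D (fun s => heat (t - s) (W s) x).
Proof.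
move=> mW W0 mD Dt.
apply: (@eq_measurable_fun _ _ R R D
    (fun s => fine (\int[leb]_y (heat_kernel (t - s) (x - y) * W s y)%:E)%E)).
  move=> s /[!inE] /Dt; rewrite /= in_itv /= => st.
  by rewrite /heat ifF // subr_eq0 gt_eqF.
apply: measurable_funTS; apply: measurableT_comp => //.
apply: (@measurable_heat_param _ _ _ RR (fun s => t - s) (fun=> x) W) => //.
exact: measurable_funB.
Qed.

(** [u] is a mild solution of u_t = Laplacian u - k started from [phi]. With the loss on the
    left-hand side of the mild equation every term is nonnegative. The bounds on [k] mean
    k = lam u - g with 0 <= g <= lam u^2, which is how the branching reaction enters. The
    functions are defined and measurable for all real times, so that integrals over time
    intervals are integrals of restrictions. *)
Record damped_flow (lam : R) (phi : 'rV[R]_d -> R) (u k : R -> 'rV[R]_d -> R) : Prop := {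
  flow_rate_gt0 : 0 < lam;
  flow_init : meas_bounded 1 phi;
  flow_measurable : measurable_fun [set: RR * E] (fun p => u p.1 p.2);
  flow_range : forall s y, 0 <= u s y <= 1;
  flow_loss_measurable : measurable_fun [set: RR * E] (fun p => k p.1 p.2);
  flow_loss_le : forall s y, k s y <= lam * u s y;
  flow_loss_ge : forall s y, lam * u s y - lam * u s y ^+ 2 <= k s y;
  flow0 : u 0 = phi;
  flow_mild : forall t x, 0 < t ->
    ((u t x)%:E + \int[mu]_(s in `[0%R, t[) (heat (t - s) (k s) x)%:E =
     (heat t phi x)%:E)%E }.

Context (lam : R) (phi : 'rV[R]_d -> R) (u k : R -> 'rV[R]_d -> R).
Context (flow : damped_flow lam phi u k).
Let lam0 := flow_rate_gt0 flow.
Let phi1 := flow_init flow.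
Let mu_ := flow_measurable flow.
Let u01 := flow_range flow.
Let mk := flow_loss_measurable flow.
Let kle := flow_loss_le flow.
Let kge := flow_loss_ge flow.
Let u0 := flow0 flow.
Let mild := flow_mild flow.

Lemma loss_ge0 s y : 0 <= k s y.
Proof.
apply: le_trans (kge s y); have /andP[u0' u1] := u01 s y.
by rewrite -mulrBr mulr_ge0 ?(ltW lam0) // subr_ge0 expr2 ler_piMl.
Qed.

Lemma meas_bounded_flow s : meas_bounded 1 (u s).
Proof.
split; last exact: u01.
exact: (@measurableT_comp _ _ _ _ _ _ _ _ (pair s) mu_ (pair1_measurable s)).
Qed.

Lemma meas_bounded_loss s : meas_bounded lam (k s).
Proof.
split=> [|y].
  exact: (@measurableT_comp _ _ _ _ _ _ _ _ (pair s) mk (pair1_measurable s)).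
rewrite loss_ge0 (le_trans (kle s y)) // ler_piMr ?(ltW lam0) //.
by case/andP: (u01 s y).
Qed.

(** Apply the heat operator for the remaining time t - r to the mild equation at time r; by the
    semigroup property the two heat operators in each term merge. *)
Lemma duhamel_lt r t x : 0 < r < t ->
  ((heat (t - r) (u r) x)%:E + \int[mu]_(s in `[0%R, r[) (heat (t - s) (k s) x)%:E =
   (heat t phi x)%:E)%E.
Proof.
move=> /andP[r0 rt]; pose a := t - r.
have a0 : 0 < a by rewrite subr_gt0.
have -> : heat t phi x = heat a (heat r phi) x.
  by rewrite (heat_heat _ (ltW a0) (ltW r0) phi1) /a subrK.
rewrite (heat_EFin _ a0 (meas_bounded_heat (ltW r0) phi1)).
pose G (p : E * RR) : \bar R := if (0 <= p.2) && (p.2 < r) then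
  ((heat_kernel a (x - p.1))%:E *
  \int[leb]_z (heat_kernel (r - p.2) (p.1 - z) * k p.2 z)%:E)%E else 0%E.
have mG : measurable_fun setT G.
  apply: measurable_fun_ifT => //.
    apply: measurable_and.
      exact: measurable_fun_ler.
    exact: measurable_fun_ltr.
  apply: emeasurable_funM.
    apply/measurable_EFinP.
    exact: measurableT_comp (measurable_heat_kernelB a x) measurable_fst.
  apply: (@measurable_heat_param _ _ _ (E * RR)%type (fun p => r - p.2) fst (fun p => k p.2)).
  - exact: measurable_funB.
  - by move=> i; exact: measurableT_comp (@measurable_coord R 1 d 0 i) measurable_fst.
  - have -> : (fun p : (E * RR) * E => k p.1.2 p.2) =
        (fun p : RR * E => k p.1 p.2) \o (fun p => (p.1.2, p.2)) by [].
    apply: (measurableT_comp mk); apply: measurable_fun_pair => //.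
    exact: measurableT_comp measurable_snd measurable_fst.
  - by move=> p y; exact: loss_ge0.
have G0 p : (0 <= G p)%E.
  rewrite /G; case: ifP => // _; apply: mule_ge0; first by rewrite lee_fin heat_kernel_ge0.
  by apply: integral_ge0 => z _; apply: heat_integrand_ge0 => y; exact: loss_ge0.
have GE s y : 0 <= s < r -> G (y, s) = (heat_kernel a (x - y) * heat (r - s) (k s) y)%:E.
  move=> /[dup] /andP[_ sr] sP.
  rewrite /G /= sP [RHS]EFinM (heat_EFin _ _ (meas_bounded_loss s)) //.
  by rewrite subr_gt0.
have fub := fubini_tonelli (m1 := leb) (m2 := mu) G mG G0.
transitivity ((heat a (u r) x)%:E + \int[leb]_y \int[mu]_s G (y, s))%E.
  congr (_ + _)%E; rewrite fub integral_mkcond; apply: eq_integral => s _.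
  rewrite patchE mem_setE in_itv /=; case: ifPn => [/[dup] /andP[s0 sr] sP|sP].
    have rs0 : 0 < r - s by rewrite subr_gt0.
    have -> : t - s = a + (r - s) by rewrite /a; lra.
    rewrite -(heat_heat _ (ltW a0) (ltW rs0) (meas_bounded_loss s)).
    rewrite (heat_EFin _ a0 (meas_bounded_heat (ltW rs0) (meas_bounded_loss s))).
    by apply: eq_integral => y _; rewrite GE.
  by rewrite integral0_eq // => y _; rewrite /G /= (negbTE sP).
rewrite (heat_EFin _ a0 (meas_bounded_flow r)) -ge0_integralD //; last 4 first.
- by move=> y _; apply: heat_integrand_ge0 => z; case/andP: (u01 r z).
- by apply: measurable_heat_integrand; case: (meas_bounded_flow r).
- by move=> y _; apply: integral_ge0.
- exact: measurable_fun_fubini_tonelli_F.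
apply: eq_integral => y _; rewrite [RHS]EFinM -mild // ge0_muleDr; last 2 first.
- by rewrite lee_fin; case/andP: (u01 r y).
- apply: integral_ge0 => s; rewrite /= in_itv /= => /andP[_ sr].
  by rewrite lee_fin; apply: heat_ge0 => z; exact: loss_ge0.
rewrite -EFinM; congr (_ + _)%E.
rewrite -ge0_integralZl //; last 3 first.
- apply/measurable_EFinP; apply: (measurable_heat_time _ mk) => //.
  + exact: loss_ge0.
  + by apply: subset_itvr; rewrite bnd_simp.
- by move=> s _; rewrite lee_fin; apply: heat_ge0 => z; exact: loss_ge0.
- by rewrite lee_fin heat_kernel_ge0.
rewrite [RHS]integral_mkcond; apply: eq_integral => s _.
rewrite patchE mem_setE in_itv /=; case: ifPn => sP; first by rewrite GE // -EFinM.
by rewrite /G /= (negbTE sP).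
Qed.

Lemma duhamel r t x : 0 <= r <= t ->
  ((heat (t - r) (u r) x)%:E + \int[mu]_(s in `[0%R, r[) (heat (t - s) (k s) x)%:E =
   (heat t phi x)%:E)%E.
Proof.
move=> /andP[]; rewrite le_eqVlt => /predU1P[<- _|r0].
  by rewrite set_itv_ge ?bnd_simp ?ltxx // integral_set0 adde0 subr0 u0.
rewrite le_eqVlt => /predU1P[<-|rt]; last by apply: duhamel_lt; rewrite r0.
by rewrite subrr heat0 mild.
Qed.

Lemma duhamel_from T r t x : 0 <= T <= r -> r <= t ->
  ((heat (t - r) (u r) x)%:E + \int[mu]_(s in `[T, r[) (heat (t - s) (k s) x)%:E =
   (heat (t - T) (u T) x)%:E)%E.
Proof.
move=> TP rt; have r0 : 0 <= r by case/andP: TP => /le_trans; apply.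
have := @balance_tail R 0 r (fun s => heat (t - s) (u s) x)
  (fun s => heat (t - s) (k s) x) r0.
apply => //.
- apply: (measurable_heat_time _ mk) => //; first exact: loss_ge0.
  apply: (@subset_trans _ `]-oo, r[); first by apply: subset_itvr; rewrite bnd_simp.
  by apply: subset_itvl; rewrite bnd_simp.
- by move=> s _; apply: heat_ge0 => y; case/andP: (u01 s y).
- by move=> s _; apply: heat_ge0; exact: loss_ge0.
move=> s /andP[s0 sr]; rewrite duhamel ?s0 ?(le_trans sr) //.
by rewrite subr0 u0.
Qed.

Lemma le_u_heat t x : 0 <= t -> u t x <= heat t phi x.
Proof.
move=> t0; have := @duhamel t t x; rewrite subrr heat0 t0 lexx => /(_ isT).
rewrite -lee_fin => <-; rewrite leeDl //; apply: integral_ge0 => s _.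
by rewrite lee_fin; apply: heat_ge0; exact: loss_ge0.
Qed.

Lemma heat_u_le s t x : 0 <= s <= t -> heat (t - s) (u s) x <= heat t phi x.
Proof.
move=> /andP[s0 st]; have ts0 : 0 <= t - s by rewrite subr_ge0.
rewrite -[in leRHS](subrK s t) -(heat_heat _ ts0 s0 phi1).
apply: (le_heat _ ts0 (meas_bounded_flow s) (meas_bounded_heat s0 phi1)) => y.
exact: le_u_heat.
Qed.

(** For fixed [t] and [x] the flow at time s, carried to time t by the heat semigroup, obeys
    the scalar balance equation, which the estimates below rely on. *)
Lemma flow_balance (T t : R) x : 0 <= T <= t ->
  let psi s := heat (t - s) (u s) x in
  let loss s := heat (t - s) (k s) x in
  [/\ measurable_fun `[T, t[ psi, measurable_fun `[T, t[ loss,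
     forall s, T <= s <= t -> 0 <= psi s,
     forall s, T <= s < t -> 0 <= loss s &
     forall r, T <= r <= t ->
       ((psi r)%:E + \int[mu]_(s in `[T, r[) (loss s)%:E = (psi T)%:E)%E].
Proof.
move=> /andP[T0 Tt] psi loss.
have sub : `[T, t[ `<=` `]-oo, t[ by apply: subset_itvr; rewrite bnd_simp.
split.
- by apply: (measurable_heat_time _ mu_) => // s y; case/andP: (u01 s y).
- by apply: (measurable_heat_time _ mk) => //; exact: loss_ge0.
- by move=> s _; apply: heat_ge0 => y; case/andP: (u01 s y).
- by move=> s _; apply: heat_ge0 => y; exact: loss_ge0.
- by move=> r /andP[Tr rt]; apply: duhamel_from => //; rewrite T0.
Qed.

Lemma loss_rate_le (s t : R) x : s <= t ->
  heat (t - s) (k s) x <= lam * heat (t - s) (u s) x.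
Proof.
move=> st; have ts0 : 0 <= t - s by rewrite subr_ge0.
rewrite -(heatZ _ ts0 (ltW lam0) (meas_bounded_flow s)).
apply: (le_heat _ ts0 (meas_bounded_loss s)) => //.
split=> [|y]; first by apply: measurable_funM => //; case: (meas_bounded_flow s).
have /andP[? ?] := u01 s y.
by rewrite mulr_ge0 ?(ltW lam0) // ler_piMr // ltW.
Qed.

(** The loss rate is at most lam, which the weight exp (lam s) compensates. *)
Lemma exp_u_nondecreasing (T t : R) x : 0 <= T <= t ->
  expR (lam * T) * heat (t - T) (u T) x <= expR (lam * t) * u t x.
Proof.
move=> TtP; have /andP[T0 Tt] := TtP.
have [mpsi mloss psi0 loss0 eq] := flow_balance x TtP.
have := exp_weight_nondecreasing Tt mpsi mloss psi0 loss0 eq (ltW lam0).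
rewrite subrr heat0; apply=> s /andP[_ st]; apply: loss_rate_le; exact: ltW.
Qed.

(** Where u <= 1/4 the loss is at least lam u (1 - u) >= 3/4 lam u. Any rate above lam / 2
    would do for [exp_u_increment]. *)
Lemma exp_u_decay (t0 t : R) x : 0 <= t0 ->
  (forall s y, t0 <= s -> u s y <= 4^-1) -> 0 <= t ->
  expR (3 / 4 * lam * t) * u t x <= expR (3 / 4 * lam * t0) * heat t phi x.
Proof.
move=> t00 u4 t_ge0; set rho := 3 / 4 * lam.
have rho0 : 0 < rho by rewrite mulr_gt0 // divr_gt0.
have [tt0|t0t] := leP t t0.
  apply: ler_pM; rewrite ?expR_ge0 ?le_u_heat //; first by case/andP: (u01 t x).
  by rewrite ler_expR ler_wpM2l // ltW.
have t0P : 0 <= t0 <= t by rewrite t00 ltW.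
have [mpsi mloss psi0 loss0 eq] := flow_balance x t0P.
have := @exp_weight_le _ _ _ _ _
  (ltW t0t) mpsi mloss psi0 loss0 eq rho 0 1 (ltW rho0) (lexx 0) ltr01.
rewrite subrr heat0 !mul0r addr0 => h; apply: le_trans (h _) _; last first.
  by rewrite ler_wpM2l ?expR_ge0 // heat_u_le.
move=> s /andP[t0s st]; rewrite mul0r addr0.
have ts0 : 0 <= t - s by rewrite subr_ge0 ltW.
rewrite -(heatZ _ ts0 (ltW rho0) (meas_bounded_flow s)).
apply: (le_heat _ ts0 _ (meas_bounded_loss s)) => [|y].
  split=> [|y]; first by apply: measurable_funM => //; case: (meas_bounded_flow s).
  have /andP[? ?] := u01 s y.
  rewrite mulr_ge0 ?(ltW rho0) //= (le_trans (ler_wpM2l (ltW rho0) (_ : u s y <= 1))) //.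
  by rewrite /rho; have := lam0; lra.
apply: le_trans (kge s y); rewrite /rho.
have /andP[uy0 _] := u01 s y; have uy4 := u4 s y t0s.
have : lam * u s y * u s y <= lam * u s y * 4^-1.
  by rewrite ler_wpM2l // mulr_ge0 // ltW.
lra.
Qed.

(** Relative to a loss at the full rate lam, the deficit is at most lam u^2. Its two factors u
    decay like exp (- 3/4 lam s) each, which beats the weight exp (lam s) by exp (- lam s / 2);
    one of the factors P_s phi is bounded by 1 and the other one evolves into P_t phi. *)
Lemma exp_u_increment (C T t : R) x :
  0 <= C -> (forall s y, 0 <= s -> expR (3 / 4 * lam * s) * u s y <= C * heat s phi y) ->
  0 <= T <= t ->
  expR (lam * t) * u t x <= expR (lam * T) * heat (t - T) (u T) x
    + 2 * C ^+ 2 * expR (- (lam / 2) * T) * heat t phi x.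
Proof.
move=> C0 uC TtP; have /andP[T0 Tt] := TtP.
have [mpsi mloss psi0 loss0 eq] := flow_balance x TtP.
have h0 : 0 <= heat t phi x by apply: heat_ge0 => y; exact: meas_bounded_ge0 phi1.
have B0 : 0 <= lam * C ^+ 2 * heat t phi x by rewrite !mulr_ge0 ?(ltW lam0) ?exprn_ge0.
have l20 : 0 < lam / 2 by rewrite divr_gt0.
have := @exp_weight_le _ _ _ _ _ Tt mpsi mloss psi0 loss0 eq lam _ _ (ltW lam0) B0 l20.
rewrite subrr heat0 => h; apply: le_trans (h _) _; last first.
  rewrite lerD2l le_eqVlt; apply/orP; left; apply/eqP.
  have -> : lam * C ^+ 2 * heat t phi x / (lam / 2) = 2 * C ^+ 2 * heat t phi x.
    rewrite invfM invrK; have := mulVf (lt0r_neq0 lam0).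
    move: lam^-1 => i il; have := congr1 (fun w => 2 * C ^+ 2 * heat t phi x * w) il; lra.
  by rewrite mulrAC.
move=> s /andP[Ts st]; have s0 : 0 <= s := le_trans T0 Ts.
have ts0 : 0 <= t - s by rewrite subr_ge0 ltW.
pose c := lam * C ^+ 2 * expR (- (lam + lam / 2) * s).
have c0 : 0 <= c by rewrite !mulr_ge0 ?expR_ge0 ?exprn_ge0 ?(ltW lam0).
have hs := meas_bounded_heat s0 phi1.
have -> : lam * C ^+ 2 * heat t phi x * expR (- (lam + lam / 2) * s) =
    heat (t - s) (fun y => c * heat s phi y) x.
  by rewrite (heatZ _ ts0 c0 hs) (heat_heat _ ts0 s0 phi1) subrK /c mulrAC.
have chs : meas_bounded c (fun y => c * heat s phi y).
  split=> [|y]; first by apply: measurable_funM => //; case: hs.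
  by rewrite mulr_ge0 ?(meas_bounded_ge0 _ hs) //= ler_piMr ?(meas_bounded_le _ hs).
rewrite -(heatZ _ ts0 (ltW lam0) (meas_bounded_flow s)) -(heatD _ ts0 (meas_bounded_loss s) chs).
have lu : meas_bounded lam (fun y => lam * u s y).
  split=> [|y]; first by apply: measurable_funM => //; case: (meas_bounded_flow s).
  have /andP[? ?] := u01 s y.
  by rewrite mulr_ge0 ?(ltW lam0) //= ler_piMr // ltW.
have lc : lam <= lam + c by rewrite lerDl.
apply: (@le_heat _ _ (lam + c)) => //.
- split=> [|y]; first by case: lu.
  by rewrite (meas_bounded_ge0 _ lu) (le_trans (meas_bounded_le _ lu)).
- split=> [|y]; first by apply: measurable_funD; [case: (meas_bounded_loss s)|case: chs].
  rewrite addr_ge0 ?(meas_bounded_ge0 _ chs) ?loss_ge0 //=.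
  by rewrite lerD ?(meas_bounded_le _ chs) ?(meas_bounded_le _ (meas_bounded_loss s)).
move=> y; rewrite -lerBlDr; apply: le_trans (kge s y); apply: lerB; first exact: lexx.
set p := heat s phi y; set w := u s y; set e := expR (3 / 4 * lam * s).
have p0 : 0 <= p by exact: meas_bounded_ge0 hs.
have p1 : p <= 1 by exact: meas_bounded_le hs.
have w0 : 0 <= w by case/andP: (u01 s y).
have e0 : 0 < e by exact: expR_gt0.
have ewp : e * w <= C * p by exact: uC.
have ee : e ^+ 2 * expR (- (lam + lam / 2) * s) = 1.
  by rewrite -expRM_natl -expRD (_ : _ + _ = 0) ?expR0 //; lra.
have sq : (e * w) ^+ 2 <= C ^+ 2 * p.
  apply: le_trans (_ : (C * p) ^+ 2 <= _).
    by rewrite ler_pXn2r ?nnegrE ?mulr_ge0 // ltW.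
  by rewrite exprMn ler_wpM2l ?exprn_ge0 // expr2 ler_piMl.
have -> : w ^+ 2 = expR (- (lam + lam / 2) * s) * (e * w) ^+ 2.
  by rewrite exprMn mulrA [expR _ * _]mulrC ee mul1r.
rewrite /c [leRHS](_ : _ = lam * (expR (- (lam + lam / 2) * s) * (C ^+ 2 * p))).
  by rewrite ler_wpM2l ?(ltW lam0) // ler_wpM2l ?expR_ge0.
by lra.
Qed.

End duhamel.

(** * Translations of the heat kernel *)

Section heat_kernel_modulus.
Context (R : realType).

(** With 0 <= p <= q: if q - p >= 1 the left side is at most 1; otherwise bound it by
    exp (- p^2) (q - p) (2 p + (q - p)) and absorb the factor 2 p through
    2 p <= 1 + p^2 <= exp (p^2). *)
Lemma expRNsqr_lipschitz (p q : R) :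
  `|expR (- p ^+ 2) - expR (- q ^+ 2)| <= 2 * `|p - q|.
Proof.
wlog pq : p q / `|p| <= `|q|.
  move=> wl; have [|/ltW] := leP `|p| `|q|; first exact: wl.
  by move=> /wl; rewrite distrC (distrC q).
have sq : p ^+ 2 <= q ^+ 2.
  by rewrite -(real_normK (num_real p)) -(real_normK (num_real q)) ler_pXn2r ?nnegrE.
rewrite ger0_norm; last by rewrite subr_ge0 ler_expR lerN2.
have dpq : `|q| - `|p| <= `|p - q| by rewrite distrC; exact: lerB_dist.
apply: (@le_trans _ _ (2 * (`|q| - `|p|))); last by rewrite ler_wpM2l.
rewrite -(real_normK (num_real p)) -(real_normK (num_real q)).
have := normr_ge0 p; move: `|p| `|q| pq {sq dpq} => a b ab a0.
have e1 : expR (- a ^+ 2) <= 1 by rewrite expR_le1 oppr_le0 sqr_ge0.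
have e0 := expR_ge0 (- a ^+ 2).
have ea : expR (- a ^+ 2) * (2 * a) <= 1.
  apply: (@le_trans _ _ (expR (- a ^+ 2) * expR (a ^+ 2))).
    rewrite ler_wpM2l //; apply: le_trans (expR_ge1Dx (a ^+ 2)).
    by have := sqr_ge0 (a - 1); rewrite expr2; lra.
  by rewrite -expRD addNr expR0.
have [ba1|ba1] := leP 1 (b - a).
  by have := expR_ge0 (- b ^+ 2); lra.
have eb : expR (- a ^+ 2) - expR (- b ^+ 2) <= expR (- a ^+ 2) * (b ^+ 2 - a ^+ 2).
  have -> : expR (- b ^+ 2) = expR (- a ^+ 2) * expR (- (b ^+ 2 - a ^+ 2)).
    by rewrite -expRD; congr expR; lra.
  rewrite -[X in X - _]mulr1 -mulrBr ler_wpM2l //.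
  by have := expR_ge1Dx (- (b ^+ 2 - a ^+ 2)); lra.
apply: le_trans eb _.
have -> : expR (- a ^+ 2) * (b ^+ 2 - a ^+ 2) =
    (b - a) * (expR (- a ^+ 2) * (2 * a) + expR (- a ^+ 2) * (b - a)) by lra.
rewrite mulrC ler_wpM2r ?subr_ge0 //.
have : expR (- a ^+ 2) * (b - a) <= 1 * 1 by apply: ler_pM; rewrite ?subr_ge0 // ltW.
lra.
Qed.

Lemma prod_dist_le (I : Type) (s : seq I) (a b : I -> R) :
  (forall i, 0 <= a i <= 1) -> (forall i, 0 <= b i <= 1) ->
  `|\prod_(i <- s) a i - \prod_(i <- s) b i| <= \sum_(i <- s) `|a i - b i|.
Proof.
move=> a01 b01; elim: s => [|i s IH]; first by rewrite !big_nil subrr normr0.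
rewrite !big_cons; set A := \prod_(j <- s) a j in IH *; set B := \prod_(j <- s) b j in IH *.
have A0 : 0 <= A by apply: prodr_ge0 => j _; case/andP: (a01 j).
have A1 : A <= 1 by apply: prodr_ile1 => j _.
have -> : a i * A - b i * B = (a i - b i) * A + b i * (A - B) by lra.
apply: le_trans (ler_normD _ _) _; rewrite !normrM (ger0_norm A0).
have /andP[bi0 bi1] := b01 i; rewrite (ger0_norm bi0) lerD //.
  by rewrite ler_piMr.
by apply: le_trans IH; rewrite ler_piMl.
Qed.

(** On the scale of its peak the kernel varies over distances of order sqrt a. The bound by 1
    provides the majorant for dominated convergence. *)
Lemma heat_kernel_modulus d (a : R) (x y : 'rV[R]_d) : 0 < a ->
  `|heat_kernel a (x - y) - heat_kernel a x| <=
  (4 * pi * a) `^ (- (d%:R / 2)) * Num.min 1 (\sum_(j < d) `|y 0 j| / Num.sqrt a).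
Proof.
move=> a0; set P := (4 * pi * a) `^ (- (d%:R / 2)).
have P0 : 0 <= P by exact: powR_ge0.
pose g (z : 'rV[R]_d) j := expR (- (z 0 j / (2 * Num.sqrt a)) ^+ 2).
have g01 z j : 0 <= g z j <= 1 by rewrite expR_ge0 expR_le1 oppr_le0 sqr_ge0.
have gE z : heat_kernel a z = P * \prod_(j < d) g z j.
  rewrite /heat_kernel -expR_sum; congr (_ * expR _).
  rewrite -sumrN mulr_suml; apply: eq_bigr => j _; rewrite expr_div_n exprMn.
  by rewrite sqr_sqrtr ?ltW // expr2; lra.
have prod01 z : 0 <= \prod_(j < d) g z j <= 1.
  by rewrite prodr_ge0 ?prodr_ile1 // => j _; case/andP: (g01 z j).
rewrite !gE -mulrBr normrM (ger0_norm P0) ler_wpM2l // le_min; apply/andP; split.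
  have /andP[? ?] := prod01 x; have /andP[? ?] := prod01 (x - y).
  by rewrite ler_norml; apply/andP; split; lra.
apply: le_trans (prod_dist_le _ (g01 _) (g01 _)) _.
apply: ler_sum => j _; apply: le_trans (expRNsqr_lipschitz _ _) _.
have s0 : 0 < Num.sqrt a by rewrite sqrtr_gt0.
rewrite -mulrBl normrM !mxE [x 0 j - _ - _]addrAC subrr sub0r normrN.
rewrite normfV (gtr0_norm (_ : 0 < 2 * Num.sqrt a)) ?mulr_gt0 // invfM.
by rewrite le_eqVlt; apply/orP; left; apply/eqP; lra.
Qed.

End heat_kernel_modulus.

(** * Long-time spreading of the heat flow *)

Section heat_spreading.
Context (R : realType) (d : nat).
Local Notation E := (borel 'rV[R]_d).
Local Notation leb := (lebesgue_mx R 1 d).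

(** Under the integral against [f], the kernel at x - y is compared with the kernel at x in two
    inequalities between nonnegative integrals, so that no signed integral occurs. *)
Lemma heat_near_kernel L (f b : 'rV[R]_d -> R) (m j a P : R) x : 0 < a -> 0 <= P ->
  meas_bounded L f -> (\int[leb]_y (f y)%:E = m%:E)%E ->
  measurable_fun setT (b : E -> R) -> (forall y, 0 <= b y) ->
  (\int[leb]_y (b y * f y)%:E = j%:E)%E ->
  (forall y, `|heat_kernel a (x - y) - heat_kernel a x| <= P * b y) ->
  `|heat a f x - heat_kernel a x * m| <= P * j.
Proof.
move=> a0 P0 fL fm mb b0 fj Kb; have f0 y := meas_bounded_ge0 y fL.
have mf : measurable_fun setT (f : E -> R) by case: fL.
have k0 z : 0 <= heat_kernel a z by exact: heat_kernel_ge0.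
have mK := measurable_heat_kernelB a x.
have Km : (\int[leb]_y (heat_kernel a x * f y)%:E = (heat_kernel a x * m)%:E)%E.
  rewrite [RHS]EFinM -fm -ge0_integralZl ?lee_fin //.
  - exact/measurable_EFinP.
  - by move=> y _; rewrite lee_fin.
have Pj : (\int[leb]_y (P * (b y * f y))%:E = (P * j)%:E)%E.
  rewrite [RHS]EFinM -fj -ge0_integralZl ?lee_fin //.
  - by apply/measurable_EFinP; exact: measurable_funM.
  - by move=> y _; rewrite lee_fin mulr_ge0.
have le1 : heat a f x <= heat_kernel a x * m + P * j.
  rewrite -lee_fin EFinD -Km -Pj (heat_EFin _ a0 fL) -ge0_integralD //.
  - apply: ge0_le_integral => //.
    + by move=> y _; exact: heat_integrand_ge0.
    + exact: measurable_heat_integrand.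
    + by apply: emeasurable_funD; apply/measurable_EFinP; do ?exact: measurable_funM;
        apply: measurable_funM => //; exact: measurable_funM.
    + move=> y _; rewrite -EFinD lee_fin mulrA -mulrDl ler_wpM2r //.
      by have := Kb y; rewrite ler_norml => /andP[_]; lra.
  - by move=> y _; rewrite lee_fin mulr_ge0.
  - by apply/measurable_EFinP; exact: measurable_funM.
  - by move=> y _; rewrite lee_fin !mulr_ge0.
  - by apply/measurable_EFinP; apply: measurable_funM => //; exact: measurable_funM.
have le2 : heat_kernel a x * m <= heat a f x + P * j.
  rewrite -lee_fin EFinD -Km -Pj (heat_EFin _ a0 fL) -ge0_integralD //.
  - apply: ge0_le_integral => //.
    + by move=> y _; rewrite lee_fin mulr_ge0.
    + by apply/measurable_EFinP; exact: measurable_funM.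
    + apply: emeasurable_funD; first exact: measurable_heat_integrand.
      by apply/measurable_EFinP; apply: measurable_funM => //; exact: measurable_funM.
    + move=> y _; rewrite -EFinD lee_fin mulrA -mulrDl ler_wpM2r //.
      by have := Kb y; rewrite ler_norml => /andP[+ _]; lra.
  - by move=> y _; exact: heat_integrand_ge0.
  - exact: measurable_heat_integrand.
  - by move=> y _; rewrite lee_fin !mulr_ge0.
  - by apply/measurable_EFinP; apply: measurable_funM => //; exact: measurable_funM.
by rewrite ler_norml; apply/andP; split; lra.
Qed.

Definition norm1 (y : 'rV[R]_d) := \sum_(j < d) `|y 0 j|.

Lemma norm1_ge0 y : 0 <= norm1 y. Proof. by apply: sumr_ge0. Qed.

Lemma measurable_norm1 : measurable_fun setT (norm1 : E -> R).
Proof.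
apply: measurable_sum => j; apply: measurableT_comp => //.
exact: measurable_coord.
Qed.

(** The modulus of [heat_kernel_modulus] at the time (n + 1)^2. *)
Definition cutoff (n : nat) (y : 'rV[R]_d) : R := Num.min 1 (norm1 y / n.+1%:R).

Lemma cutoff_itv n y : 0 <= cutoff n y <= 1.
Proof. by rewrite le_min ler01 divr_ge0 ?norm1_ge0 // ge_min lexx. Qed.

Lemma measurable_cutoff n : measurable_fun setT (cutoff n : E -> R).
Proof.
apply: measurable_minr => //; apply: measurable_funM => //.
exact: measurable_norm1.
Qed.

Lemma cutoff_integral_cvg0 L (f : 'rV[R]_d -> R) (m : R) :
  meas_bounded L f -> (\int[leb]_y (f y)%:E = m%:E)%E ->
  (\int[leb]_y (cutoff n y * f y)%:E)%E @[n --> \oo] --> 0%E.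
Proof.
move=> fL fm; have f0 y := meas_bounded_ge0 y fL.
have mf : measurable_fun setT (f : E -> R) by case: fL.
have mcf n : measurable_fun setT (fun y : E => (cutoff n y * f y)%:E).
  by apply/measurable_EFinP; apply: measurable_funM => //; exact: measurable_cutoff.
have fint : leb.-integrable setT (EFin \o (f : E -> R)).
  apply/integrableP; split; first exact/measurable_EFinP.
  rewrite (_ : \int[leb]_y _ = m%:E)%E ?ltry // -fm; apply: eq_integral => y _.
  by rewrite /= ger0_norm.
have cvg0 : {ae leb, forall y, setT y ->
    (cutoff n y * f y)%:E @[n --> \oo] --> 0%E}.
  apply: nearW => y _; apply/fine_cvgP; split; first exact: nearW.
  rewrite -[0](mul0r (f y)); apply: cvgM; last exact: cvg_cst.
  apply: (@squeeze_cvgr _ _ _ _ (cst 0) (fun n => norm1 y * n.+1%:R^-1)).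
  - by apply: nearW => n; case/andP: (cutoff_itv n y) => -> _; rewrite ge_min lexx orbT.
  - exact: cvg_cst.
  - rewrite -[X in _ --> X](mulr0 (norm1 y)); apply: cvgM; first exact: cvg_cst.
    exact: cvg_harmonic.
have dom : {ae leb, forall y n, setT y -> (`|(cutoff n y * f y)%:E| <= (f y)%:E)%E}.
  apply: nearW => y n _ /=; have /andP[c0 c1] := cutoff_itv n y.
  by rewrite lee_fin ger0_norm ?mulr_ge0 // ler_piMl.
have [_ _] := dominated_convergence measurableT mcf
  (measurable_cst (0%E : \bar R)) cvg0 fint dom.
by rewrite integral0.
Qed.

(** After a long time only the mass of [f] is visible on the scale of the peak: the relative
    error is the average of [cutoff] against [f], which vanishes by dominated convergence. *)
Lemma heat_spreading L (f : 'rV[R]_d -> R) (m e : R) :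
  meas_bounded L f -> (\int[leb]_y (f y)%:E = m%:E)%E -> 0 < e ->
  exists2 a0, 0 < a0 & forall a x, a0 <= a ->
    `|heat a f x - heat_kernel a x * m| <= e * (4 * pi * a) `^ (- (d%:R / 2)).
Proof.
move=> fL fm e0; have f0 y := meas_bounded_ge0 y fL.
have mf : measurable_fun setT (f : E -> R) by case: fL.
have := cutoff_integral_cvg0 fL fm.
move=> /fine_cvgP[[N1 _ fin]] /cvgrPdist_lt /(_ _ e0)[N2 _ small].
pose n := maxn N1 N2.
have /fineK jE := fin n (leq_maxl _ _).
have := small n (leq_maxr _ _); rewrite /= sub0r normrN => je.
set j := fine _ in jE je.
exists (n.+1%:R ^+ 2) => [|a x na]; first by rewrite exprn_gt0.
have a0 : 0 < a by apply: lt_le_trans na; rewrite exprn_gt0.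
apply: le_trans (heat_near_kernel (b := cutoff n)
  (P := (4 * pi * a) `^ (- (d%:R / 2))) a0 _ fL fm _ _ (esym jE) _) _.
- exact: powR_ge0.
- exact: measurable_cutoff.
- by move=> y; case/andP: (cutoff_itv n y).
- move=> y; apply: le_trans (heat_kernel_modulus x y a0) _.
  rewrite ler_wpM2l ?powR_ge0 // le_min ge_min lexx /= ge_min; apply/orP; right.
  rewrite -mulr_suml ler_wpM2l ?norm1_ge0 // lef_pV2 ?posrE ?sqrtr_gt0 //.
  by rewrite -(ler_pXn2r (n := 2)) ?nnegrE // ?sqrtr_ge0 // sqr_sqrtr // ltW.
rewrite mulrC ler_wpM2r ?powR_ge0 //; apply: ltW.
by apply: le_lt_trans je; exact: ler_norm.
Qed.

End heat_spreading.

(** * Asymptotics of a damped flow at one particle *)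

Lemma heat_constant_small (R : realType) (d : nat) (M e : R) : (0 < d)%N -> 0 < e ->
  exists2 t0, 0 < t0 & forall t, t0 <= t -> (4 * pi * t) `^ (- (d%:R / 2)) * M <= e.
Proof.
move=> d0 e0; exists (1 + (M / e) ^+ 2) => [|t tt0].
  by rewrite ltr_pwDl ?ltr01 ?sqr_ge0.
have t1 : 1 <= t by apply: le_trans tt0; rewrite lerDl sqr_ge0.
have y1 : t <= 4 * pi * t.
  by rewrite -[leLHS]mul1r ler_wpM2r ?(le_trans ler01) //; have := @pi_ge2 R; lra.
(* as the base is at least 1 and d >= 1, the exponent d / 2 may be lowered to 1 / 2 *)
have yd : Num.sqrt (4 * pi * t) <= (4 * pi * t) `^ (d%:R / 2).
  rewrite -powR12_sqrt ?(le_trans _ y1) ?(le_trans ler01) //.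
  by apply: ler_powR; [exact: le_trans y1|rewrite ler_peMl ?invr_ge0 // ler1n].
have p0 : 0 < (4 * pi * t) `^ (d%:R / 2).
  by rewrite powR_gt0 // (lt_le_trans _ y1) // (lt_le_trans ltr01).
rewrite powRN mulrC ler_pdivrMr // mulrC -ler_pdivrMr //.
apply: le_trans yd; apply: le_trans (ler_norm _) _; rewrite -sqrtr_sqr.
by apply: ler_wsqrtr; apply: le_trans y1; apply: le_trans tt0; rewrite lerDr.
Qed.

Section single_particle.
Context (R : realType) (d : nat).
Local Notation leb := (lebesgue_mx R 1 d).
Local Notation peak t := ((4 * pi * t) `^ (- (d%:R / 2))).
Context (lam M : R) (phi : 'rV[R]_d -> R) (u k : R -> 'rV[R]_d -> R).
Context (d0 : (0 < d)%N).
Context (flow : damped_flow lam phi u k).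
Context (phiM : (\int[leb]_x (phi x)%:E = M%:E)%E).
Let lam0 := flow_rate_gt0 flow.
Let phi1 := flow_init flow.

Let M0 : 0 <= M.
Proof.
rewrite -lee_fin -phiM; apply: integral_ge0 => x _.
by rewrite lee_fin (meas_bounded_ge0 _ phi1).
Qed.

Lemma exp_u_decay_exists : exists2 C, 0 <= C &
  forall s y, 0 <= s -> expR (3 / 4 * lam * s) * u s y <= C * heat s phi y.
Proof.
have e4 : 0 < 4^-1 :> R by rewrite invr_gt0.
have [t0 t00 small] := heat_constant_small M d0 e4.
exists (expR (3 / 4 * lam * t0)) => [|s y s0]; first exact: expR_ge0.
apply: (exp_u_decay flow) => //; first exact: ltW.
move=> r z t0r; have r0 := lt_le_trans t00 t0r.
apply: le_trans (le_u_heat flow z (ltW r0)) _.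
exact: le_trans (heat_le_mass z r0 phi1 phiM) (small r t0r).
Qed.

Definition mass t := fine (\int[leb]_x (u t x)%:E)%E.

Lemma massE t : 0 <= t -> (\int[leb]_x (u t x)%:E = (mass t)%:E)%E.
Proof.
move=> t0; rewrite /mass fineK // ge0_fin_numE; last first.
  by apply: integral_ge0 => x _; rewrite lee_fin; case/andP: (flow_range flow t x).
apply: le_lt_trans (ltry M); rewrite -phiM -(integral_heat t0 phi1).
apply: ge0_le_integral => //.
- by move=> x _; rewrite lee_fin; case/andP: (flow_range flow t x).
- by apply/measurable_EFinP; case: (meas_bounded_flow flow t).
- by apply/measurable_EFinP; case: (meas_bounded_heat t0 phi1).
- by move=> x _; rewrite lee_fin (le_u_heat flow).
Qed.

Lemma mass0 : mass 0 = M.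
Proof. by rewrite /mass (flow0 flow) phiM. Qed.

Lemma mass_ge0 t : 0 <= mass t.
Proof.
apply: fine_ge0; apply: integral_ge0 => x _; rewrite lee_fin.
by case/andP: (flow_range flow t x).
Qed.

Lemma integral_heat_u T t : 0 <= T <= t ->
  (\int[leb]_x (expR (lam * T) * heat (t - T) (u T) x)%:E =
   (expR (lam * T) * mass T)%:E)%E.
Proof.
move=> /andP[T0 Tt]; have tT : 0 <= t - T by rewrite subr_ge0.
have [mh h01] := meas_bounded_heat tT (meas_bounded_flow flow T).
rewrite [RHS]EFinM -massE // -(integral_heat tT (meas_bounded_flow flow T)) -ge0_integralZl //.
- exact/measurable_EFinP.
- by move=> x _; rewrite lee_fin; case/andP: (h01 x).
Qed.

Lemma exp_mass_nondecreasing T t : 0 <= T <= t ->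
  expR (lam * T) * mass T <= expR (lam * t) * mass t.
Proof.
move=> TtP; have /andP[T0 Tt] := TtP; have t0 := le_trans T0 Tt.
have tP : 0 <= t <= t by rewrite t0 lexx.
rewrite -lee_fin -(integral_heat_u TtP) -(integral_heat_u tP).
have tT : 0 <= t - T by rewrite subr_ge0.
have [mh h01] := meas_bounded_heat tT (meas_bounded_flow flow T).
apply: ge0_le_integral => //.
- by move=> x _; rewrite lee_fin mulr_ge0 ?expR_ge0 //; case/andP: (h01 x).
- by apply/measurable_EFinP; exact: measurable_funM.
- apply/measurable_EFinP; apply: measurable_funM => //.
  by rewrite subrr heat0; case: (meas_bounded_flow flow t).
by move=> x _; rewrite lee_fin subrr heat0; exact: (exp_u_nondecreasing flow).
Qed.

Lemma exp_mass_increment (C T t : R) : 0 <= C ->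
  (forall s y, 0 <= s -> expR (3 / 4 * lam * s) * u s y <= C * heat s phi y) ->
  0 <= T <= t ->
  expR (lam * t) * mass t <=
  expR (lam * T) * mass T + 2 * C ^+ 2 * expR (- (lam / 2) * T) * M.
Proof.
move=> C0 uC TtP; have /andP[T0 Tt] := TtP; have t0 := le_trans T0 Tt.
have tP : 0 <= t <= t by rewrite t0 lexx.
rewrite -lee_fin EFinD -(integral_heat_u TtP) -(integral_heat_u tP).
have tT : 0 <= t - T by rewrite subr_ge0.
have [mh h01] := meas_bounded_heat tT (meas_bounded_flow flow T).
have [mp p01] := meas_bounded_heat t0 phi1.
have c0 : 0 <= 2 * C ^+ 2 * expR (- (lam / 2) * T).
  by rewrite !mulr_ge0 ?expR_ge0 ?exprn_ge0.
have -> : (2 * C ^+ 2 * expR (- (lam / 2) * T) * M)%:E =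
    (\int[leb]_x (2 * C ^+ 2 * expR (- (lam / 2) * T) * heat t phi x)%:E)%E.
  rewrite EFinM -phiM -(integral_heat t0 phi1) -ge0_integralZl //.
  - exact/measurable_EFinP.
  - by move=> x _; rewrite lee_fin; case/andP: (p01 x).
rewrite -ge0_integralD //.
- apply: ge0_le_integral => //.
  + move=> x _; rewrite lee_fin mulr_ge0 ?expR_ge0 // subrr heat0.
    by case/andP: (flow_range flow t x).
  + apply/measurable_EFinP; apply: measurable_funM => //.
    by rewrite subrr heat0; case: (meas_bounded_flow flow t).
  + by apply: emeasurable_funD; apply/measurable_EFinP; exact: measurable_funM.
  move=> x _; rewrite -EFinD lee_fin subrr heat0.
  exact: (exp_u_increment flow).
- by move=> x _; rewrite lee_fin mulr_ge0 ?expR_ge0 //; case/andP: (h01 x).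
- by apply/measurable_EFinP; exact: measurable_funM.
- by move=> x _; rewrite lee_fin mulr_ge0 //; case/andP: (p01 x).
- by apply/measurable_EFinP; exact: measurable_funM.
Qed.

(** The weighted masses are nondecreasing and their later increments tend to 0 with T, so the
    supremum is their limit. *)
Lemma exp_mass_cvg (C : R) : 0 <= C ->
  (forall s y, 0 <= s -> expR (3 / 4 * lam * s) * u s y <= C * heat s phi y) ->
  exists m, forall T, 0 <= T -> expR (lam * T) * mass T <= m <=
    expR (lam * T) * mass T + 2 * C ^+ 2 * expR (- (lam / 2) * T) * M.
Proof.
move=> C0 uC; pose S := [set expR (lam * T) * mass T | T in [set T | 0 <= T]].
have ubS (T : R) : 0 <= T -> ubound S
    (expR (lam * T) * mass T + 2 * C ^+ 2 * expR (- (lam / 2) * T) * M).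
  move=> T0 _ [t /= t0 <-]; have [Tt|/ltW tT] := leP T t.
    by apply: exp_mass_increment => //; rewrite T0.
  apply: (@le_trans _ _ (expR (lam * T) * mass T)).
    by apply: exp_mass_nondecreasing; rewrite t0.
  by rewrite lerDl !mulr_ge0 ?expR_ge0 ?exprn_ge0.
have S0 : S !=set0 by exists (expR (lam * 0) * mass 0); exists 0 => //=.
exists (sup S) => T T0; apply/andP; split.
  by apply: ub_le_sup; [eexists; exact: (ubS 0)|exists T].
by apply: ge_sup => //; exact: ubS.
Qed.

(** Beyond a time [T] the weighted flow is the heat flow of [u T] up to a fraction of
    [heat t phi] that is small with exp (- lam T / 2). Both heat flows spread like the kernel,
    so in the long run their ratio is the ratio of the masses, which in turn is close to the
    ratio of the limiting mass to the initial one. A flow without initial mass vanishes, and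
    then any constant fits. *)
Lemma exp_u_asymptotics : exists c B, [/\ 0 < c, c <= B,
  forall t x, 0 <= t -> expR (lam * t) * u t x <= B * heat t phi x &
  forall e, 0 < e -> exists2 t1, 0 < t1 & forall t x, t1 <= t ->
    `|expR (lam * t) * u t x - c * heat t phi x| <= e * peak t].
Proof.
have [C C0 uC] := exp_u_decay_exists.
have [m mP] := exp_mass_cvg C0 uC.
pose D := 2 * C ^+ 2; have D0 : 0 <= D by rewrite mulr_ge0 ?exprn_ge0.
have uD (t : R) x : 0 <= t -> expR (lam * t) * u t x <= (1 + D) * heat t phi x.
  move=> t0; have tP : (0 : R) <= 0 <= t by rewrite lexx t0.
  have := exp_u_increment flow x C0 uC tP.
  by rewrite !mulr0 expR0 mul1r mulr1 subr0 (flow0 flow) -/D; lra.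
have [Mz|Mn0] := eqVneq M 0.
  exists 1, (1 + D); split => //; first by rewrite lerDl.
  move=> e e0; exists 1 => // t x t1; have t0 := lt_le_trans ltr01 t1.
  have h0 : heat t phi x = 0.
    apply/eqP; rewrite eq_le; have := heat_le_mass x t0 phi1 phiM.
    rewrite Mz mulr0 => -> /=; apply: heat_ge0 => y; exact: meas_bounded_ge0 phi1.
  have -> : u t x = 0.
    apply/eqP; rewrite eq_le -{1}h0 (le_u_heat flow) ?(ltW t0) //.
    by case/andP: (flow_range flow t x).
  by rewrite h0 !mulr0 subrr normr0 mulr_ge0 ?powR_ge0 // ltW.
have Mgt0 : 0 < M by rewrite lt_neqAle eq_sym Mn0 M0.
have /andP[mM mD] := mP 0 (lexx 0).
rewrite !mulr0 expR0 mul1r mass0 mulr1 -/D in mM mD.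
exists (m / M), (1 + D); split => //.
- by rewrite divr_gt0 // (lt_le_trans Mgt0).
- by rewrite ler_pdivrMr //; lra.
move=> e e0.
have [T T0 Tsmall] : exists2 T, 0 <= T & D * expR (- (lam / 2) * T) * M <= e / 4.
  (* with y = lam T / 2 = 4 D M / e, the inequality exp y >= y suffices *)
  exists (8 * D * M / (lam * e)).
    by rewrite divr_ge0 ?mulr_ge0 // ltW.
  set y := (lam / 2) * (8 * D * M / (lam * e)).
  have yE : y = 4 * (D * M / e).
    rewrite /y invfM; have := mulVf (lt0r_neq0 lam0); move: lam^-1 => i il.
    by have := congr1 (fun w => 4 * D * M * e^-1 * w) il; lra.
  have e1 : expR (- y) * expR y = 1 by rewrite -expRD addNr expR0.
  have ye := expR_ge1Dx y; have ey := expR_gt0 (- y).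
  rewrite mulNr -/y mulrAC -(ler_pM2r (expR_gt0 y)) -[leLHS]mulrA e1 mulr1.
  apply: (@le_trans _ _ (e / 4 * y)); last by rewrite ler_wpM2l ?divr_ge0 ?(ltW e0) //; lra.
  rewrite yE; have := mulVf (lt0r_neq0 e0); move: e^-1 => i il.
  by have := congr1 (fun w => D * M * w) il; lra.
pose E := expR (lam * T); have E0 : 0 <= E by exact: expR_ge0.
pose Q := 2 `^ (d%:R / 2) : R; have Q0 : 0 < Q by exact: powR_gt0.
have [r rE] : exists r, r = E * mass T / M by exists (E * mass T / M).
have r0 : 0 <= r by rewrite rE divr_ge0 ?mulr_ge0 ?mass_ge0.
have Er0 : 0 < E + r by rewrite ltr_pwDl ?expR_gt0.
(* the precision for the two spreading estimates: they are multiplied by [E] and [r], and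
   passing from the peak at time t - T to the peak at time t costs the factor [Q] *)
pose e1 := e / 4 / (Q * (E + r)).
have e10 : 0 < e1 by rewrite !divr_gt0 ?mulr_gt0.
have [a1 a10 spread1] := heat_spreading (meas_bounded_flow flow T) (massE T0) e10.
have hT := meas_bounded_heat T0 phi1.
have hTM : (\int[leb]_x (heat T phi x)%:E = M%:E)%E by rewrite (integral_heat T0 phi1).
have [a2 a20 spread2] := heat_spreading hT hTM e10.
exists (a1 + a2 + 2 * T + 1) => [|t x tP].
  by rewrite ltr_wpDl // !addr_ge0 ?mulr_ge0 ?(ltW a10) ?(ltW a20).
have Tt : T <= t by lra.
have t0 : 0 < t by lra.
have tT0 : 0 < t - T by lra.
have TtP : 0 <= T <= t by rewrite T0.
have s1 := spread1 (t - T) x (_ : a1 <= t - T).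
have s2 := spread2 (t - T) x (_ : a2 <= t - T).
rewrite (heat_heat _ (ltW tT0) T0 phi1) subrK in s2.
have {}s1 := s1 ltac:(lra); have {}s2 := s2 ltac:(lra).
have peakQ : peak (t - T) <= Q * peak t.
  rewrite /Q !powRN ler_pdivlMr ?powR_gt0 ?mulr_gt0 ?pi_gt0 //.
  rewrite ler_pdivrMl ?powR_gt0 ?mulr_gt0 ?pi_gt0 //.
  rewrite -powRM ?mulr_ge0 ?pi_ge0 ?(ltW t0) ?(ltW tT0) //.
  apply: ge0_ler_powR; rewrite ?nnegrE ?mulr_ge0 ?pi_ge0 ?(ltW t0) ?(ltW tT0) //.
  have := @pi_gt0 R; nra.
have lo := exp_u_nondecreasing flow x TtP.
have hi := exp_u_increment flow x C0 uC TtP.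
have hp := heat_le_mass x t0 phi1 phiM.
have h0 : 0 <= heat t phi x by apply: heat_ge0 => y; exact: meas_bounded_ge0 phi1.
have pk0 : 0 <= peak t by exact: powR_ge0.
have /andP[m1 m2] := mP T T0.
set X := expR (lam * t) * u t x in lo hi *; set h := heat t phi x in hi hp h0 s2 *.
set w := heat (t - T) (u T) x in lo hi s1; set K := heat_kernel _ _ in s1 s2.
set et := expR (- (lam / 2) * T) in hi Tsmall m2.
rewrite -/E -/D in lo hi m1 m2.
have et0 : 0 <= D * et by rewrite mulr_ge0 ?expR_ge0.
have small0 : D * et * (peak t * M) <= e / 4 * peak t.
  by rewrite mulrCA [leRHS]mulrC ler_wpM2l.
have A1 : `|E * w - r * h| <= e / 4 * peak t.
  have -> : E * w - r * h = E * (w - K * mass T) - r * (h - K * M).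
    have -> : r * (h - K * M) = r * h - E * mass T * K.
      by rewrite mulrBr; congr (_ - _); rewrite rE mulrCA divfK // mulrC.
    lra.
  apply: le_trans (ler_normB _ _) _; rewrite !normrM (ger0_norm E0) (ger0_norm r0).
  apply: (@le_trans _ _ ((E + r) * (e1 * peak (t - T)))).
    by rewrite mulrDl lerD // ler_wpM2l.
  apply: (@le_trans _ _ ((E + r) * (e1 * (Q * peak t)))).
    by rewrite ler_wpM2l ?(ltW Er0) // ler_wpM2l ?(ltW e10).
  have e1E : e1 * (Q * (E + r)) = e / 4 by rewrite divfK // gt_eqF // mulr_gt0.
  by rewrite -e1E le_eqVlt; apply/orP; left; apply/eqP; lra.
have A2 : D * et * h <= e / 4 * peak t.
  by apply: le_trans small0; rewrite ler_wpM2l.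
have rm : 0 <= m / M - r <= D * et.
  by rewrite rE -mulrBl divr_ge0 ?subr_ge0 //= ler_pdivrMr // lerBlDl.
have A3 : 0 <= (m / M - r) * h <= e / 4 * peak t.
  case/andP: rm => rm0 rm1; rewrite mulr_ge0 //=.
  by apply: le_trans A2; rewrite ler_wpM2r.
move: A1 A3; rewrite ler_norml => /andP[A1 A1'] /andP[A3 A3'].
have ep : 0 <= e * peak t by rewrite mulr_ge0 // ltW.
have -> : X - m / M * h = (X - E * w) + (E * w - r * h) - (m / M - r) * h by lra.
by rewrite ler_norml; apply/andP; split; lra.
Qed.

End single_particle.

(** * The branching reaction *)

Section reaction.
Context (R : realType) (q : nat -> R).
Context (q_ge0 : forall k, (1 <= k)%N -> 0 <= q k).
Context (q_sum1 : (\sum_(1 <= k <oo) (q k)%:E = 1)%E).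

Lemma q_partial_sum_le1 n : \sum_(1 <= k < n) q k <= 1.
Proof.
rewrite -lee_fin -q_sum1 -sumEFin.
have -> : (\sum_(1 <= k < n) (q k)%:E = \sum_(1 <= k < n | (1 <= k)%N) (q k)%:E)%E.
  by apply: big_nat_widenl.
have -> : (\sum_(1 <= k <oo) (q k)%:E = \sum_(1 <= k <oo | (1 <= k)%N) (q k)%:E)%E.
  by congr (limn _); apply/funext => m; apply: big_nat_widenl.
by apply: nneseries_lim_ge => k k1 _; rewrite lee_fin q_ge0.
Qed.

(** If q_1 were 1, all the other q_k would vanish and the mean would be 1. *)
Lemma q1_lt1 : (1 < \sum_(1 <= k <oo) (k%:R * q k)%:E)%E -> q 1 < 1.
Proof.
move=> mean; rewrite ltNge; apply/negP => q1.
suff : (\sum_(1 <= k <oo) (k%:R * q k)%:E = \sum_(1 <= k <oo) (q k)%:E)%E.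
  by move=> h; move: mean; rewrite h q_sum1 ltxx.
congr (limn _); apply/funext => n; apply: eq_big_nat => k /andP[k1 _].
have [->|k1'] := eqVneq k 1%N; first by rewrite mul1r.
have kgt1 : (1 < k)%N by rewrite ltn_neqAle eq_sym k1'.
suff -> : q k = 0 by rewrite mulr0.
apply/eqP; rewrite eq_le q_ge0 // andbT.
have := q_partial_sum_le1 k.+1; rewrite big_nat_recr //= big_ltn //.
have : 0 <= \sum_(2 <= i < k) q i.
  by rewrite big_nat; apply: sumr_ge0 => i /andP[i2 _]; rewrite q_ge0 // ltnW.
lra.
Qed.

Section unit_interval.
Context (r : R).
Context (r01 : 0 <= r <= 1).
Let psum n := \sum_(1 <= k < n) q k * r ^+ k.

Lemma reaction_term_ge0 k : (1 <= k)%N -> 0 <= q k * r ^+ k.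
Proof. by move=> k1; rewrite mulr_ge0 ?q_ge0 // exprn_ge0 //; case/andP: r01. Qed.

Lemma reaction_psum_nondecreasing : nondecreasing_seq psum.
Proof.
apply/nondecreasing_seqP => n; rewrite /psum; case: n => [|n].
  by rewrite !big_geq.
by rewrite [leRHS]big_nat_recr //= lerDl reaction_term_ge0.
Qed.

(** r^k <= r^2 for k >= 2, and the corresponding coefficients sum to at most 1 - q_1. *)
Lemma reaction_psum_le n : psum n <= q 1 * r + (1 - q 1) * r ^+ 2.
Proof.
have /andP[r0 r1] := r01.
have q10 : 0 <= q 1 by exact: q_ge0.
have q11 : q 1 <= 1.
  by have := q_partial_sum_le1 2; rewrite big_nat1.
apply: le_trans (reaction_psum_nondecreasing (leq_addl 2 n)) _.
rewrite /psum big_ltn ?ltn_addr // expr1 lerD2l.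
apply: (@le_trans _ _ (\sum_(2 <= k < 2 + n) q k * r ^+ 2)).
  rewrite !big_nat; apply: ler_sum => k /andP[k2 _].
  rewrite ler_wpM2l ?q_ge0 ?(ltnW k2) // -(subnK k2) exprD ler_piMl ?sqr_ge0 //.
  by rewrite exprn_ile1.
rewrite -mulr_suml ler_wpM2r ?sqr_ge0 //.
by have := q_partial_sum_le1 (2 + n); rewrite big_ltn ?ltn_addr //; lra.
Qed.

Lemma reaction_psum_cvg : psum n @[n --> \oo] --> r + reaction q r.
Proof.
have -> : r + reaction q r = limn psum by rewrite /reaction addrA subrr add0r.
apply: nondecreasing_is_cvgn; first exact: reaction_psum_nondecreasing.
by exists (q 1 * r + (1 - q 1) * r ^+ 2) => _ [n _ <-]; exact: reaction_psum_le.
Qed.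

Lemma reaction_le : reaction q r <= - (1 - q 1) * r + (1 - q 1) * r ^+ 2.
Proof.
have : r + reaction q r <= q 1 * r + (1 - q 1) * r ^+ 2.
  rewrite -(cvg_lim _ reaction_psum_cvg) //; apply: limr_le.
    by apply/cvg_ex; exists (r + reaction q r); exact: reaction_psum_cvg.
  by apply: nearW => n; exact: reaction_psum_le.
lra.
Qed.

Lemma reaction_ge : - (1 - q 1) * r <= reaction q r.
Proof.
have : q 1 * r <= r + reaction q r.
  rewrite -(cvg_lim _ reaction_psum_cvg) //; apply: limr_ge.
    by apply/cvg_ex; exists (r + reaction q r); exact: reaction_psum_cvg.
  near=> n; apply: le_trans (reaction_psum_nondecreasing (_ : (2 <= n)%N)).
    by rewrite /psum big_nat1 expr1.
  by near: n; exists 2%N.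
lra.
Unshelve. all: by end_near. Qed.

End unit_interval.
End reaction.

Section mild_flow.
Context (R : realType) (d : nat) (q : nat -> R).
Local Notation E := (borel 'rV[R]_d).
Local Notation RR := (measurableTypeR R).
Local Notation mu := (@lebesgue_measure R).
Context (q_ge0 : forall k, (1 <= k)%N -> 0 <= q k).
Context (q_sum1 : (\sum_(1 <= k <oo) (q k)%:E = 1)%E).
Context (q1_lt1 : q 1 < 1).
Context (phi : 'rV[R]_d -> R) (u : R -> 'rV[R]_d -> R).
Context (phi1 : meas_bounded 1 phi).
Context (u_mild : mild_solution q phi u).

(** A mild solution is measurable on nonnegative times; the extension by 0 is measurable on
    the whole line. *)
Definition extend0 (s : R) (y : 'rV[R]_d) : R := if 0 <= s then u s y else 0.

Lemma extend0_measurable :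
  measurable_fun [set: RR * E] (fun p => extend0 p.1 p.2).
Proof.
have [mu_ _ _ _] := u_mild.
have mD : measurable [set tx : (RR * E)%type | (0 : R) <= tx.1].
  have := @measurable_fun_ler _ (RR * E)%type R setT (fun=> 0) fst
    (measurable_cst _) measurable_fst measurableT [set true].
  rewrite setTI => /(_ _); rewrite (_ : _ @^-1` _ = [set tx : (RR * E)%type | (0 : R) <= tx.1]).
    exact.
  by apply/seteqP; split.
have := (measurable_restrictT _ mD).1 mu_.
congr (measurable_fun _ _); apply/funext => -[s y].
by rewrite patchE /extend0 mem_setE /=.
Qed.

(** The loss is minus the reaction. The two forms of the mild equation differ in the sign of
    the integral and in the endpoint s = t, which is a null set. *)
Lemma mild_solution_damped_flow :
  damped_flow (1 - q 1) phi extend0 (fun s y => - reaction q (extend0 s y)).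
Proof.
have [_ u01 u0 mild] := u_mild.
have e01 s y : 0 <= extend0 s y <= 1.
  by rewrite /extend0; case: ifP => s0; [exact: u01|rewrite lexx ler01].
have lam0 : 0 < 1 - q 1 by rewrite subr_gt0.
have mk : measurable_fun [set: RR * E] (fun p => - reaction q (extend0 p.1 p.2)).
  apply: measurable_funN.
  have -> : (fun p : RR * E => reaction q (extend0 p.1 p.2)) =
      fun p => (extend0 p.1 p.2 + reaction q (extend0 p.1 p.2)) - extend0 p.1 p.2.
    by apply/funext => p; rewrite addrAC subrr add0r.
  apply: measurable_funB; last exact: extend0_measurable.
  apply: (@measurable_fun_cvg _ (RR * E)%type R setT
    (fun n (p : (RR * E)%type) => \sum_(1 <= k < n) q k * extend0 p.1 p.2 ^+ k)).
    move=> n; apply: measurable_sum => k; apply: measurable_funM => //.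
    by apply: measurable_funX; exact: extend0_measurable.
  by move=> p _; exact: reaction_psum_cvg.
split => //.
- exact: extend0_measurable.
- by move=> s y; have := reaction_ge q_ge0 q_sum1 (e01 s y); lra.
- by move=> s y; have := reaction_le q_ge0 q_sum1 (e01 s y); lra.
- by apply/funext => x; rewrite /extend0 lexx u0.
move=> t x t0.
pose k s (y : 'rV[R]_d) := - reaction q (extend0 s y).
have kP s : meas_bounded (1 - q 1) (k s).
  split.
    exact: (@measurableT_comp _ _ _ _ _ _ _ _ (pair s) mk (pair1_measurable s)).
  move=> y; have /andP[e0 e1] := e01 s y.
  have := reaction_ge q_ge0 q_sum1 (e01 s y); have := reaction_le q_ge0 q_sum1 (e01 s y).
  have : 0 <= (1 - q 1) * extend0 s y * (1 - extend0 s y).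
    by rewrite !mulr_ge0 ?subr_ge0 // ltW.
  have : (1 - q 1) * extend0 s y <= 1 - q 1 by rewrite ler_piMr // ltW.
  by move=> h1 h2 h3 h4; rewrite /k; apply/andP; split; lra.
have k0 s y : 0 <= k s y by exact: meas_bounded_ge0 (kP s).
have mh : measurable_fun `[0, t[ (fun s => heat (t - s) (k s) x).
  apply: (measurable_heat_time _ mk) => //.
  by apply: subset_itvr; rewrite bnd_simp.
pose I := (\int[mu]_(s in `[0%R, t[) (heat (t - s) (k s) x)%:E)%E.
have I0 : (0 <= I)%E.
  by apply: integral_ge0 => s _; rewrite lee_fin heat_ge0.
have Ifin : I \is a fin_num.
  rewrite ge0_fin_numE //.
  apply: (@le_lt_trans _ _ (\int[mu]_(s in `[0%R, t[) (cst (1 - q 1)%:E s))%E).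
    apply: ge0_le_integral => //.
    - by move=> s _; rewrite lee_fin heat_ge0.
    - exact/measurable_EFinP.
    - move=> s; rewrite /= in_itv /= => /andP[_ st]; rewrite lee_fin.
      by apply: heat_le_bound (kP s); rewrite subr_ge0 ltW.
  rewrite integral_cst //= lebesgue_measure_itv /= lte_fin t0.
  by rewrite -EFinB -EFinM ltry.
rewrite {1}/extend0 (ltW t0) mild // -/I -(fineK Ifin) -EFinD; congr EFin.
suff -> : \int[mu]_(s in `[0, t]) heat (t - s) (fun y => reaction q (u s y)) x = - fine I.
  by rewrite subrK.
have -> : \int[mu]_(s in `[0, t]) heat (t - s) (fun y => reaction q (u s y)) x =
    \int[mu]_(s in `[0, t]) - heat (t - s) (k s) x.
  apply: eq_Rintegral => s; rewrite inE /= in_itv /= => /andP[s0 _].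
  rewrite -heatN //; congr (heat _ _ x); apply/funext => y.
  by rewrite /k /extend0 s0 opprK.
rewrite /Rintegral -fineN; congr fine.
rewrite /I integral_itv_bndo_bndc; last exact/measurable_EFinP.
rewrite -integral_ge0N; last by move=> s _; rewrite lee_fin heat_ge0.
by apply: eq_integral => s _; rewrite EFinN.
Qed.

End mild_flow.

(** * Markov processes and measurability of configurations *)

Section markov_marginal.
Context (R : realType) dT (T : measurableType dT).
Context dO (Omega : measurableType dO).

Lemma probability_setI_almost_sure (P : probability Omega R) (F A : set Omega) :
  measurable F -> measurable A -> P F = 1%E -> P (F `&` A) = P A.
Proof.
move=> mF mA PF.
have F0 : P (~` F) = 0%E by rewrite probability_setC // PF subee.
have AF0 : P (A `\` F) = 0%E.
  apply/eqP; rewrite eq_le measure_ge0 andbT -F0; apply: le_measure.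
  - by rewrite inE; exact: measurableD.
  - by rewrite inE; exact: measurableC.
  - by move=> w [].
transitivity (P (A `\` F) + P (A `&` F))%E; first by rewrite AF0 add0e setIC.
exact/esym/(measureDI P mA mF).
Qed.

(** Apply the Markov property at time 0 to the event that the process starts at [x]. This event
    has probability one and belongs to the past at time 0, and on it the integrand is constant,
    however the transition function depends on the starting point. *)
Lemma markov_marginal (Q : R -> T -> set T -> \bar R) (P : T -> probability Omega R)
    (X : R -> Omega -> option T) x t G :
  markov_process Q P X -> measurable [set x] -> 0 <= t -> measurable G ->
  P x (alive_in X t G) = Q t x G.
Proof.
move=> [mX X0 PX] mx t0 mG; pose F := alive_in X 0 [set x].
have mF : measurable F by exact: mX.
have FE : F = [set w | X 0 w = Some x].
  by apply/seteqP; split => w; [case=> y -> Xw; exact: esym|move=> Xw; exists x].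
have PF : P x F = 1%E by rewrite FE X0.
rewrite -(probability_setI_almost_sure mF (mX _ _ t0 mG) PF).
rewrite -[in LHS](add0r t) PX //; last first.
  by apply: sub_sigma_algebra; exists 0, [set x]; split => //; rewrite lexx.
rewrite (eq_integral (cst (Q t x G))); last first.
  by move=> w; rewrite inE FE /= => ->.
by rewrite integral_cst // [X in (_ * X)%E](PF : _ = 1%E) mule1.
Qed.

End markov_marginal.

Section conf_measurability.
Context (R : realType) (d : nat).
Local Notation E := (borel 'rV[R]_d).
Local Notation C := (borel (conf R d)).

Lemma perm_enum_conf_of_mx k (x : 'M[R]_(k, d)) :
  perm_eq (enum_mset (conf_of_mx x)) [seq row i x | i <- enum 'I_k].
Proof. exact: perm_eq_seq_mset. Qed.

Definition npts (A : set 'rV[R]_d) (nu : conf R d) : nat :=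
  count (fun x => `[< A x >]) (enum_mset nu).

Lemma npts_conf_of_mx A k (x : 'M[R]_(k, d)) :
  npts A (conf_of_mx x) = count (fun i => `[< A (row i x) >]) (enum 'I_k).
Proof. by rewrite /npts (permP (perm_enum_conf_of_mx x)) count_map. Qed.

Lemma near_row_open k (U : set 'rV[R]_d) (x : 'M[R]_(k, d)) : open U ->
  \forall y \near x, forall i, U (row i x) -> U (row i y).
Proof.
move=> oU; have FF : Filter (nbhs x) by exact: nbhs_filter.
suff H (i : 'I_k) : \forall y \near x, U (row i x) -> U (row i y).
  exact: (@filter_forall _ _ (fun i y => U (row i x) -> U (row i y)) (nbhs x) _ H).
have [Ux|Ux] := pselect (U (row i x)); last first.
  by apply: (@nearW _ (nbhs x) _ FF) => y /Ux.
have /nbhs_ballP[e /= e0 eU] : nbhs (row i x) U by exact: open_nbhs_nbhs.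
apply/nbhs_ballP; exists e => //= y [_ xy] _; apply: eU; split => // a b.
by rewrite !mxE; exact: xy.
Qed.

(** Points lying in an open set stay there under small perturbations, so their number can only
    increase nearby. *)
Lemma open_npts_gt (U : set 'rV[R]_d) n : open U ->
  open [set nu : conf R d | (n < npts U nu)%N].
Proof.
move=> oU; change (open_conf [set nu : conf R d | (n < npts U nu)%N]) => k.
rewrite openE => x /= nx; near=> y.
rewrite /= npts_conf_of_mx; apply: leq_trans nx _; rewrite npts_conf_of_mx.
apply: sub_count => i /asboolP Ui; apply/asboolP; move: Ui; move: i.
by near: y; exact: near_row_open.
Unshelve. all: by end_near. Qed.

Lemma npts_setD (A B : set 'rV[R]_d) nu : B `<=` A ->
  (npts (A `\` B) nu + npts B nu = npts A nu)%N.
Proof.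
move=> BA; rewrite /npts; elim: (enum_mset nu) => //= x s IH.
rewrite addnACA IH; congr (_ + _)%N.
have [Bx|nBx] := pselect (B x).
  by rewrite (asboolT Bx) (asboolT (BA _ Bx)) asboolF // => -[].
rewrite (asboolF nBx) addn0; congr nat_of_bool; apply: asbool_equiv_eq.
by split=> [[]|Ax].
Qed.

Lemma npts_bigcup_nondecreasing (F : (set 'rV[R]_d)^nat) nu : nondecreasing_seq F ->
  \forall n \near \oo, npts (F n) nu = npts (\bigcup_n F n) nu.
Proof.
move=> ndF; rewrite /npts; elim: (enum_mset nu) => [|x s IH] /=; first exact: nearW.
have [[n0 _ Fx]|Fx] := pselect ((\bigcup_n F n) x).
  rewrite asboolT; last by exists n0.
  near=> n; rewrite asboolT; first by congr (_ + _)%N; near: n.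
  have /subsetPset : (F n0 <= F n)%O by apply: ndF; near: n; exists n0.
  exact.
near=> n; congr (_ + _)%N; last by near: n.
by rewrite !asboolF // => Fnx; apply: Fx; exists n.
Unshelve. all: by end_near. Qed.

Lemma measurable_npts_open (U : set 'rV[R]_d) : open U ->
  measurable_fun [set: C] (fun nu => (npts U nu)%:R : R).
Proof.
move=> oU _ Y mY; rewrite setTI.
have mgt n : measurable ([set nu | (n < npts U nu)%N] : set C).
  by apply: sub_sigma_algebra; exact: open_npts_gt.
have mge n : measurable ([set nu | (n <= npts U nu)%N] : set C).
  case: n => [|n]; last exact: mgt.
  by rewrite (_ : [set _ | _] = setT) //; apply/seteqP; split.
rewrite (_ : _ @^-1` Y = \bigcup_(n in [set n | Y n%:R])
    ([set nu : C | (n <= npts U nu)%N] `\` [set nu | (n < npts U nu)%N])).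
  apply: bigcup_measurable => n _; exact: measurableD.
apply/seteqP; split => [nu Ynu|nu [n Yn [/= nU /negP]]].
  by exists (npts U nu) => //; split => /=; rewrite ?ltnn.
by rewrite -leqNgt => Un; rewrite (_ : npts U nu = n) //; apply/eqP; rewrite eqn_leq Un.
Qed.

(** The sets A whose [hat_set] is measurable do not visibly form a lambda-system, whereas the
    number of points in A is additive in A: the pi-lambda argument is run on counts. *)
Lemma measurable_npts (A : set 'rV[R]_d) : measurable (A : set E) ->
  measurable_fun [set: C] (fun nu => (npts A nu)%:R : R).
Proof.
pose D := [set A : set 'rV[R]_d |
  measurable_fun [set: C] (fun nu => (npts A nu)%:R : R)].
suff : <<s @open 'rV[R]_d >> `<=` D by apply.
apply: lambda_system_subset => //; [exact: openI| |exact: measurable_npts_open].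
split => //.
- by apply: measurable_npts_open; exact: openT.
- move=> A1 A2 A21 mA1 mA2; rewrite /D /=.
  rewrite (_ : (fun _ => _) = fun nu => (npts A1 nu)%:R - (npts A2 nu)%:R).
    exact: measurable_funB.
  by apply/funext => nu; rewrite -(npts_setD nu A21) natrD addrK.
- move=> F ndF mF; rewrite /D /=.
  apply: (@measurable_fun_cvg _ C R setT (fun n nu => (npts (F n) nu)%:R)).
    by move=> n; exact: mF.
  move=> nu _; apply: cvg_near_cst.
  by near=> n; congr (_%:R); near: n; exact: npts_bigcup_nondecreasing.
Unshelve. all: by end_near. Qed.

Lemma measurable_hat_set (A : set 'rV[R]_d) : measurable (A : set E) ->
  measurable (hat_set A : set C).
Proof.
move=> mA; have mAC : measurable (~` A : set E) by exact: measurableC.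
have -> : hat_set A = [set: C] `&` (fun nu => (npts (~` A) nu)%:R) @^-1` [set (0 : R)].
  rewrite setTI; apply/seteqP; split => nu /=.
    move=> Anu; apply/eqP; rewrite pnatr_eq0 -leqn0 leqNgt -has_count.
    by apply/hasPn => x xnu; apply/asboolPn => nAx; apply: nAx; exact: Anu.
  move=> /eqP; rewrite pnatr_eq0 -leqn0 leqNgt -has_count => /hasPn h x xnu.
  by have /asboolPn := h x xnu; exact: contrapT.
exact: (measurable_npts mAC).
Qed.

(** A configuration is represented by finitely many matrices, one per ordering of its atoms,
    and finite sets of matrices are closed. *)
Lemma measurable_conf_set1 (mu : conf R d) : measurable ([set mu] : set C).
Proof.
rewrite -[X in measurable X]setCK; apply: measurableC; apply: sub_sigma_algebra.
change (open_conf (~` [set mu])) => k.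
have -> : [set x : 'M[R]_(k, d) | (~` [set mu]) (conf_of_mx x)] =
  ~` [set x | conf_of_mx x = mu] by [].
rewrite openC.
have T1 : accessible_space 'M[R]_(k, d) by apply: hausdorff_accessible; exact: norm_hausdorff.
apply: (accessible_finite_set_closed.1 T1).
pose g (s : seq 'rV[R]_d) : 'M[R]_(k, d) := \matrix_(i, j) (nth 0 s i) 0 j.
apply: (@sub_finite_set _ _ (g @` [set` permutations (enum_mset mu)])).
  move=> x /= xmu; exists [seq row i x | i <- enum 'I_k].
    by rewrite /= mem_permutations -xmu perm_sym perm_enum_conf_of_mx.
  apply/matrixP => i j; rewrite mxE (nth_map i) ?size_enum_ord //.
  by rewrite nth_ord_enum mxE.
by apply: finite_image; exact: finite_seq.
Qed.

Lemma hat_indic (A : set 'rV[R]_d) : hat \1_A = \1_(hat_set A) :> (conf R d -> R).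
Proof.
apply/funext => nu; rewrite /hat indicE.
have [Anu|nAnu] := pselect (hat_set A nu).
  rewrite mem_set // big_seq big1 // => x xnu; rewrite indicE mem_set //; exact: Anu.
rewrite memNset //; have /existsNP[x /not_implyP[xnu nAx]] := nAnu.
apply/eqP; rewrite prodf_seq_eq0; apply/hasP; exists x => //=.
by rewrite indicE memNset.
Qed.

Lemma hat_conf_of_mx k (phi : 'rV[R]_d -> R) (x : 'M[R]_(k, d)) :
  hat phi (conf_of_mx x) = \prod_(i < k) phi (row i x).
Proof.
rewrite /hat (perm_big _ (perm_enum_conf_of_mx x)) big_map.
by rewrite -[in RHS]big_enum /=.
Qed.

(** The particles move independently: integrate one row of the matrix at a time. *)
Lemma conf_heat_hat L t (phi : 'rV[R]_d -> R) (mu : conf R d) : 0 < t ->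
  meas_bounded L phi -> conf_heat t (hat phi) mu = hat (heat t phi) mu.
Proof.
move=> t0 phiL; rewrite /conf_heat gt_eqF // /Rintegral /l1 /hat.
move: (enum_mset mu) => s; rewrite [RHS](big_nth 0) big_mkord.
rewrite -[RHS]/(fine (_%:E)).
rewrite -(@integral_lebesgue_mx_rows R (size s) d
  (fun i y => heat_kernel t (nth 0 s i - y) * phi y) (fun i => heat t phi (nth 0 s i))).
- congr fine; apply: eq_integral => y _; rewrite -/(hat _ _) hat_conf_of_mx.
  by rewrite -big_split.
- move=> i; apply: measurable_funM; first exact: measurable_heat_kernelB.
  by case: phiL.
- by move=> i y; rewrite mulr_ge0 ?heat_kernel_ge0 ?(meas_bounded_ge0 _ phiL).
- by move=> i; rewrite (heat_EFin _ t0 phiL).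
Qed.

End conf_measurability.

(** * Asymptotics for several particles *)

Lemma dist_itv0_le (R : realDomainType) (a b w : R) :
  0 <= a <= w -> 0 <= b <= w -> `|a - b| <= w.
Proof. by move=> /andP[? ?] /andP[? ?]; rewrite ler_norml; apply/andP; split; lra. Qed.

Section product_asymptotics.
Context (R : realType) (d : nat).
Local Notation leb := (lebesgue_mx R 1 d).
Local Notation peak t := ((4 * pi * t) `^ (- (d%:R / 2))).
Context (lam M : R) (phi : 'rV[R]_d -> R) (u k : R -> 'rV[R]_d -> R).
Context (d0 : (0 < d)%N).
Context (flow : damped_flow lam phi u k).
Context (phiM : (\int[leb]_x (phi x)%:E = M%:E)%E).

Lemma powR_peak_le1 (t : R) : 0 < t -> t `^ (d%:R / 2) * peak t <= 1.
Proof.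
move=> t0; have p0 : 0 < 4 * pi * t by rewrite !mulr_gt0 ?pi_gt0.
rewrite powRN ler_pdivrMr ?powR_gt0 // mul1r.
apply: ge0_ler_powR; rewrite ?nnegrE ?divr_ge0 ?(ltW t0) ?(ltW p0) //.
by rewrite -[leLHS]mul1r ler_wpM2r ?(ltW t0) //; have := @pi_ge2 R; lra.
Qed.

(** A single particle is covered by [exp_u_asymptotics]. For at least two, every factor of
    either product is at most some z = O(t^{-d/2}), and z^2 alone compensates t^{d/2}. *)
Lemma exp_prod_u_asymptotics : exists2 c, 0 < c &
  forall e, 0 < e -> exists2 t1, 0 < t1 & forall t (s : seq 'rV[R]_d), t1 <= t ->
    s != [::] ->
    t `^ (d%:R / 2) * `|expR (t * lam) * \prod_(x <- s) u t x
      - (\prod_(x <- s) c) * \prod_(x <- s) heat t phi x| <= e * (size s)%:R.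
Proof.
have [c [B [c0 cB uB asymp]]] := exp_u_asymptotics d0 flow phiM.
exists c => // e e0.
have M0 : 0 <= M.
  rewrite -lee_fin -phiM; apply: integral_ge0 => x _.
  by rewrite lee_fin (meas_bounded_ge0 _ (flow_init flow)).
have B0 : 0 <= B by rewrite (le_trans (ltW c0)).
have [t1 t10 near1] := asymp e e0.
have [t2 t20 near2] := heat_constant_small (B * M) d0 ltr01.
have [t3 t30 near3] := heat_constant_small (B * M * (B * M)) d0 e0.
exists (t1 + t2 + t3) => [|t s tP]; first by rewrite !addr_gt0.
have t0 : 0 < t by lra.
have {}near1 := near1 t _ (_ : t1 <= t).
have {}near2 := near2 t ltac:(lra); have {}near3 := near3 t ltac:(lra).
have td0 : 0 <= t `^ (d%:R / 2) by exact: powR_ge0.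
have pk0 : 0 <= peak t by exact: powR_ge0.
pose z := peak t * (B * M).
have z0 : 0 <= z by rewrite !mulr_ge0.
have h0 x : 0 <= heat t phi x by apply: heat_ge0 => y; exact: meas_bounded_ge0 (flow_init flow).
have hz x : B * heat t phi x <= z.
  rewrite /z mulrCA ler_wpM2l //; exact: heat_le_mass (flow_init flow) phiM.
have u0 x : 0 <= u t x by case/andP: (flow_range flow t x).
have u1 x : u t x <= 1 by case/andP: (flow_range flow t x).
have expuz x : expR (lam * t) * u t x <= z by apply: le_trans (hz x); exact: uB (ltW t0).
have chz x : c * heat t phi x <= z by apply: le_trans (hz x); rewrite ler_wpM2r.
have E1 : 1 <= expR (lam * t).
  by rewrite -expR0 ler_expR mulr_ge0 ?(ltW t0) // (ltW (flow_rate_gt0 flow)).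
have td_peak := powR_peak_le1 t0.
rewrite [t * lam]mulrC -big_split /=; case: s => [//|x [|y s]] _.
  rewrite !big_seq1 mulr1; apply: (@le_trans _ _ (t `^ (d%:R / 2) * (e * peak t))).
    by rewrite ler_wpM2l // near1 //; lra.
  by rewrite mulrCA ler_piMr // ltW.
have zz : t `^ (d%:R / 2) * (z * z) <= e.
  have -> : t `^ (d%:R / 2) * (z * z) =
      (t `^ (d%:R / 2) * peak t) * (peak t * (B * M * (B * M))) by rewrite /z; lra.
  by apply: le_trans near3; rewrite ler_piMl // !mulr_ge0.
apply: (@le_trans _ _ e); last by rewrite ler_peMr ?(ltW e0) // ler1n.
apply: le_trans zz; rewrite ler_wpM2l // !big_cons.
set pu := \prod_(w <- s) u t w; set ph := \prod_(w <- s) (c * heat t phi w).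
have pu01 : 0 <= pu <= 1.
  by rewrite prodr_ge0 //= prodr_ile1 // => w _; rewrite u0 u1.
have ph01 : 0 <= ph <= 1.
  rewrite prodr_ge0 /= => [|w _]; last by rewrite mulr_ge0 // ltW.
  rewrite prodr_ile1 // => w _; rewrite mulr_ge0 ?(ltW c0) //=.
  exact: le_trans (chz w) near2.
have uyz : u t y <= z.
  by apply: le_trans (expuz y); rewrite ler_peMl.
have A : 0 <= expR (lam * t) * (u t x * (u t y * pu)) <= z * z.
  case/andP: pu01 => pu0 pu1.
  rewrite !mulr_ge0 ?expR_ge0 //= mulrA; apply: ler_pM; rewrite ?mulr_ge0 ?expR_ge0 //.
  by rewrite -[leRHS]mulr1; apply: ler_pM.
have A' : 0 <= c * heat t phi x * (c * heat t phi y * ph) <= z * z.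
  case/andP: ph01 => ph0 ph1; have c0' := ltW c0.
  rewrite !mulr_ge0 //=; apply: ler_pM; rewrite ?mulr_ge0 //.
  by rewrite -[leRHS]mulr1; apply: ler_pM; rewrite ?mulr_ge0.
exact: dist_itv0_le A A'.
Qed.

End product_asymptotics.

(** The error function is the left-hand side divided by the number of particles, so that its
    uniform smallness is all there is to prove. *)
Lemma asymptotic_constant_exists (R : realType) (d : nat) (q : nat -> R)
    (H : R -> R.-pker (borel (conf R d)) ~> (borel (conf R d)))
    (phi : borel 'rV[R]_d -> R) (M : R) :
  (0 < d)%N -> (forall k, (1 <= k)%N -> 0 <= q k) ->
  (\sum_(1 <= k <oo) (q k)%:E = 1)%E -> q 1 < 1 ->
  branching_semigroup q H -> measurable_fun setT phi ->
  (forall x, 0 <= phi x <= 1) -> (\int[lebesgue_mx R 1 d]_x (phi x)%:E = M%:E)%E ->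
  exists c, asymptotic_constant q H phi c.
Proof.
move=> d0 q0 q1 ql HP mphi phi01 phiM.
have phi1 : meas_bounded 1 phi by split.
have [u u_mild Hu] := HP phi mphi phi01.
have flow := mild_solution_damped_flow q0 q1 ql phi1 u_mild.
have [c c0 asymp] := exp_prod_u_asymptotics d0 flow phiM.
exists c; split => //.
pose lhs (mu : conf R d) t := t `^ (d%:R / 2) *
  `|expR (t * (1 - q 1)) * \int[H t mu]_nu hat phi nu
    - hat (cst c) mu * conf_heat t (hat phi) mu|.
have lhs0 mu t : 0 <= lhs mu t by rewrite mulr_ge0 ?powR_ge0.
exists (fun mu t => lhs mu t / (l1 mu)%:R) => [e e0|mu t mu0 t0]; last first.
  have l0 : (l1 mu)%:R != 0 :> R.
    rewrite pnatr_eq0 size_eq0; apply/eqP => s0; apply: mu0.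
    by rewrite -[mu]seq_mset_id s0; apply/msetP => a; rewrite mset_seqE mset0E.
  by rewrite -/(lhs mu t) mulrC divfK.
have [t1 t10 near1] := asymp e e0.
near=> t => mu; have tt1 : t1 <= t by near: t; apply: nbhs_pinfty_ge; exact: num_real.
have t0 : 0 < t by exact: lt_le_trans tt1.
rewrite ger0_norm; last by rewrite divr_ge0.
rewrite /lhs (conf_heat_hat _ t0 phi1) (Hu _ _ (ltW t0)) /hat /l1.
have [->|s0] := eqVneq (enum_mset mu) [::].
  by rewrite [(size [::])%:R](_ : _ = 0) // invr0 mulr0 ltW.
rewrite ler_pdivrMr; last by rewrite ltr0n lt0n size_eq0.
have := near1 t _ tt1 s0.
rewrite (eq_bigr (fun x => u t x)) // => x _.
by rewrite /extend0 (ltW t0).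
Unshelve. all: by end_near. Qed.

Theorem corollary3p1 (R : realType) (d : nat) (q : nat -> R)
    (d_gt0 : (0 < d)%N)
    (q_ge0 : forall k, (1 <= k)%N -> 0 <= q k)
    (q_sum1 : (\sum_(1 <= k <oo) (q k)%:E = 1)%E)
    (q_mean_gt1 : (1 < \sum_(1 <= k <oo) (k%:R * q k)%:E)%E)
    (q_mean_lty : (\sum_(1 <= k <oo) (k%:R * q k)%:E < +oo)%E)
    (A : set 'rV[R]_d)
    (mA : measurable (A : set (borel 'rV[R]_d)))
    (A_lty : (lebesgue_mx R 1 d A < +oo)%E)
    (dX : measure_display) (OmegaX : measurableType dX)
    (H : R -> R.-pker (borel (conf R d)) ~> (borel (conf R d)))
    (PX : conf R d -> probability OmegaX R) (X : R -> OmegaX -> conf R d)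
    (hX : branching_process q H PX X)
    (dB : measure_display) (OmegaB : measurableType dB)
    (PB : conf R d -> probability OmegaB R)
    (B : R -> OmegaB -> option (borel (conf R d)))
    (hB : markov_process (T := borel (conf R d))
            (subprocess_transition (1 - q 1)) PB B) :
  exists2 eps : conf R d -> R -> R, uniform_o1 eps &
    forall (mu : conf R d) (t : R), mu <> zero_conf R d -> 0 < t ->
      `|fine (PX mu [set w | hat_set A (X t w)])
        - hat (cst (asymptotic_C q H \1_A)) mu *
          fine (PB mu (alive_in B t (hat_set A)))|
      <= (l1 mu)%:R * eps mu t / (expR (t * (1 - q 1)) * t `^ (d%:R / 2)).

Proof.
have ql := q1_lt1 q_ge0 q_sum1 q_mean_gt1.
have [trH HP mX _] := hX.
have mphi : measurable_fun [set: borel 'rV[R]_d] (\1_A : borel 'rV[R]_d -> R).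
  exact: measurable_indic.
have phi01 (x : 'rV[R]_d) : 0 <= (\1_A x : R) <= 1.
  by rewrite indicE; case: (_ \in _); rewrite lexx ler01.
have phiM : (\int[lebesgue_mx R 1 d]_x (\1_A x)%:E =
    (fine (lebesgue_mx R 1 d A))%:E)%E.
  by rewrite integral_indic // setIT fineK // ge0_fin_numE.
have [c0 [eps eps_o1 asymp]] : asymptotic_constant q H \1_A (asymptotic_C q H \1_A).
  by apply: getPex; exact: asymptotic_constant_exists phiM.
exists eps => // mu t mu0 t0.
have mA' := measurable_hat_set mA.
have mmu := measurable_conf_set1 mu.
have -> : PX mu [set w | hat_set A (X t w)] = H t mu (hat_set A).
  rewrite -(markov_marginal mX mmu (ltW t0) mA'); congr (PX mu _).
  apply/seteqP; split => w; [by move=> Aw; exists (X t w)|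
    by move=> [nu Anu [nuE]] /=; rewrite -nuE].
rewrite (markov_marginal hB mmu (ltW t0) mA') /subprocess_transition /=.
have := asymp mu t mu0 t0.
rewrite hat_indic {1}/Rintegral integral_indic // setIT.
set h := fine _; set C := hat _ _; set p := conf_heat _ _ _.
have E0 : 0 < expR (t * (1 - q 1)) by exact: expR_gt0.
have td0 : 0 < t `^ (d%:R / 2) by exact: powR_gt0.
rewrite ler_pdivlMr ?mulr_gt0 //; apply: le_trans.
rewrite expRN [(1 - q 1) * t]mulrC.
rewrite [leRHS]mulrC.
have -> : expR (t * (1 - q 1)) * h - C * p =
    expR (t * (1 - q 1)) * (h - C * ((expR (t * (1 - q 1)))^-1 * p)).
  by rewrite [RHS]mulrBr; congr (_ - _); rewrite [RHS]mulrCA mulVKf // gt_eqF.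
by rewrite normrM (gtr0_norm E0) mulrCA mulrA.
Qed.
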